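(* For all integers $0\le k\le r$ there is a constant $\mu$ depending only on $k$ such that for all integers $c_{k-1}>c_{k-2}>\dots>c_1>\mu$, \[f\left(r,k,\binom{c_{k-1}}{k-1}+\binom{c_{k-2}}{k-2}+\dots+\binom{c_1}{1}\right)=\binom{c_{k-1}}{k}+\binom{c_{k-2}}{k-1}+\dots+\binom{c_1}{2}.\]
   Context: $\mathbb{N}^{(s)}$ denotes the family of all $s$-element subsets of $\mathbb{N}$. For integers $0\le k\le r$ and $b\ge 0$, $f(r,k,b)$ denotes the maximum of $|\mathcal{A}|$ over all pairs of families $\mathcal{A}\subset\mathbb{N}^{(r)}$, $\mathcal{B}\subset\mathbb{N}^{(r-1)}$ with $|\mathcal{B}|=b$ such that for every $A\in\mathcal{A}$ there exist $k$ distinct sets $B_1,\dots,B_k\in\mathcal{B}$ with $B_i\subset A$ for all $i$.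
   Formalization: The case k = 0 is excluded (k ≥ 1 is assumed): for k = 0 and r ≥ 1 the family A is unconstrained, so the maximum f(r,0,b) does not exist, and the sums of binomials have no meaning there. *)

(* Defs.v *)
From HB Require Import structures.
From mathcomp Require Import all_boot all_order.
From mathcomp Require Import finmap.
Set Implicit Arguments. Unset Strict Implicit. Unset Printing Implicit Defensive.
Local Open Scope fset_scope.

Definition admissible (r k : nat) (A B : {fset {fset nat}}) : Prop :=
  (forall a, a \in A -> #|` a| = r) /\
  (forall x, x \in B -> #|` x| = r.-1) /\
  (forall a, a \in A -> k <= #|` [fset x in B | x `<=` a]|).

Definition f_is (r k b m : nat) : Prop :=
  (exists A B, admissible r k A B /\ #|` B| = b /\ #|` A| = m) /\
  (forall A B, admissible r k A B -> #|` B| = b -> #|` A| <= m).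

(* Main.v *)
Require Import Defs.
From mathcomp Require Import all_boot all_order.
From mathcomp Require Import finmap.
From mathcomp Require Import zify.
Set Implicit Arguments. Unset Strict Implicit. Unset Printing Implicit Defensive.
Local Open Scope fset_scope.
Local Open Scope nat_scope.

(** Write k = j + 1 and call a set x "removable" for A when A \ x lies in B.
    An element x splits B into the sets containing x and those avoiding x, and
    all but |B_avoiding| members of A keep k removable elements inside one of
    the two parts. If no x lying in many, but not all, sets of B exists, double
    counting shows that either A is small or every A is a core common to all of
    B plus k removable elements; the latter is the Kruskal-Katona situation and
    gives the exact bound. A first induction on |B| through the splits yields
    f(r,k,b) <= b (c + O(1)) / k, where C(c,j) <= b < C(c+1,j). For b a cascade
    with large digits every split then loses strictly against the cascade
    function, because its slope dominates the crude bound on the part cut off.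
    All estimates are independent of r. *)

(** * The cascade function *)

(** Write c for the number with C(c, j) <= b < C(c+1, j). Two demands fix the threshold at which an
    element counts as splitting. It must be at least of order b/c, so that the sets of B through x
    pay for the members the split loses; and it must be well below b, because a crude bound by a
    j-th root is applied to everything under it. At order b/c, that is c^(j-1), this root is
    negligible against c. The exact bound resists a plain induction on |B|, because the parts of a
    split need not have cascades with large digits. Hence only the larger part is followed, and the
    sizes of all parts cut off are added into one number e, charged at a superadditive cost. Once e
    exceeds a fixed fraction of b, the asymptotic bound alone is enough. *)

Lemma broot_ex l b : exists n, 'C(n, l.+1) <= b.
Proof. by exists 0; rewrite bin0n. Qed.

Lemma ltn_bin_addl l b : b < 'C(b + l.+1, l.+1).
Proof.
elim: b => [|b IH]; first by rewrite add0n binn.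
rewrite addSn binS.
have : 0 < 'C(b + l.+1, l) by rewrite bin_gt0; lia.
lia.
Qed.

Lemma broot_bound l b n : 'C(n, l.+1) <= b -> n <= b + l.+1.
Proof.
move=> H; rewrite leqNgt; apply/negP => H1.
have := leq_bin2l l.+1 (ltnW H1); have := ltn_bin_addl l b; lia.
Qed.

Definition broot l b := ex_maxn (broot_ex l b) (@broot_bound l b).

Lemma broot_le l b : 'C(broot l b, l.+1) <= b.
Proof. by rewrite /broot; case: ex_maxnP. Qed.

Lemma broot_max l b n : 'C(n, l.+1) <= b -> n <= broot l b.
Proof. by rewrite /broot; case: ex_maxnP => m _ H /H. Qed.

Lemma broot_lt l b : b < 'C((broot l b).+1, l.+1).
Proof. by rewrite ltnNge; apply/negP => /broot_max; rewrite ltnn. Qed.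

Lemma broot_uniq l b n : 'C(n, l.+1) <= b -> b < 'C(n.+1, l.+1) -> broot l b = n.
Proof.
move=> H1 H2; apply/eqP; rewrite eqn_leq broot_max // andbT leqNgt.
apply/negP => H3; have := leq_bin2l l.+1 H3; have := broot_le l b; lia.
Qed.

Lemma broot_mono l b1 b2 : b1 <= b2 -> broot l b1 <= broot l b2.
Proof. by move=> H; apply: broot_max; apply: leq_trans H; apply: broot_le. Qed.

(* [kk l] sends the cascade C(c_l, l) + ... + C(c_1, 1) to
   C(c_l, l + 1) + ... + C(c_1, 2). *)
Fixpoint kk l b :=
  if l is l'.+1 then 'C(broot l' b, l.+1) + kk l' (b - 'C(broot l' b, l)) else 0.

Lemma kk_cascade l n u : u < 'C(n, l) -> kk l.+1 ('C(n, l.+1) + u) = 'C(n, l.+2) + kk l u.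
Proof.
move=> H /=; have -> : broot l ('C(n, l.+1) + u) = n by apply: broot_uniq; rewrite ?binS; lia.
by rewrite addKn.
Qed.

Lemma kk0 l : kk l 0 = 0.
Proof.
elim: l => //= l IH; rewrite sub0n IH addn0.
apply: bin_small; rewrite ltnNge; apply/negP => H.
have := broot_le l 0; rewrite leqNgt bin_gt0; lia.
Qed.

Lemma kk_bin l n : kk l.+1 'C(n, l.+1) = 'C(n, l.+2).
Proof.
case: (leqP l n) => H; last by rewrite !bin_small ?kk0 //; lia.
by rewrite -[X in kk _ X]addn0 kk_cascade ?bin_gt0 // kk0 addn0.
Qed.

Lemma kk1 b : kk 1 b = 'C(b, 2).
Proof. by rewrite -{1}[b]bin1 kk_bin. Qed.

Lemma kk_mono l : {homo kk l : b1 b2 / b1 <= b2}.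
Proof.
elim: l => [|l IH] // b1 b2 H.
have [E|N] := eqVneq (broot l b1) (broot l b2).
  by rewrite /= E leq_add2l; apply: IH; lia.
have L : broot l b1 < broot l b2 by rewrite ltn_neqAle N broot_mono.
apply: (@leq_trans 'C((broot l b1).+1, l.+2)); last first.
  by apply: leq_trans (leq_addr _ _) => /=; rewrite leq_bin2l.
have Lt := broot_lt l b1; have Le := broot_le l b1.
case: l IH N L Lt Le => [|l] IH N L Lt Le; first by rewrite /= binS addn0; lia.
rewrite binS [kk _ b1]/= leq_add2l -/(kk l.+1 _) -[leqRHS]kk_bin; apply: IH.
by rewrite binS in Lt; lia.
Qed.

(** Equality holds at [u = 'C(n, l)]. Below it the top digit is at most [n - 1], and the slack this
    leaves absorbs the steeper average of the lower terms. *)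
Lemma kk_avg l n u : u <= 'C(n, l) -> l.+1 * kk l u <= u * (n - l).
Proof.
elim: l n u => [|l IH] n u; first by rewrite muln0.
rewrite leq_eqVlt => /orP[/eqP ->|Hu].
  by rewrite kk_bin mul_bin_left mulnC.
have Le := broot_le l u; have Lt := broot_lt l u.
set m := broot l u in Le Lt.
have mn : m < n.
  rewrite ltnNge; apply/negP => H; have := leq_bin2l l.+1 H; lia.
pose u' := u - 'C(m, l.+1).
have uE : u = 'C(m, l.+1) + u' by rewrite /u'; lia.
have u'_lt : u' < 'C(m, l) by rewrite binS in Lt; rewrite /u'; lia.
rewrite uE kk_cascade // mulnDr mul_bin_left.
have IHu := IH m u' (ltnW u'_lt).
have E := mul_bin_left m l.
have K : l.+2 * kk l u' <= u' * (m - l) + 'C(m, l.+1).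
  rewrite -(leq_pmul2l (ltn0Sn l)).
  have : u' * (m - l) <= 'C(m, l) * (m - l) by rewrite leq_mul2r ltnW ?orbT.
  nia.
case: (leqP l.+1 m) => H.
  apply: (@leq_trans (('C(m, l.+1) + u') * (m - l))); last by rewrite leq_mul2l; lia.
  have ml : m - l = (m - l.+1).+1 by lia.
  rewrite ml in K *.
  nia.
rewrite bin_small // muln0 !add0n.
have ml : m - l = 0 by lia.
by move: IHu; rewrite ml muln0 leqn0 muln_eq0 => /eqP ->; rewrite muln0.
Qed.

Lemma kk_step0 s t : (0 < t -> 0 < s) -> kk 1 t + t <= kk 1 (s + t).
Proof.
move=> H; case: (posnP t) => [-> | /H s0]; first by rewrite kk0.
apply: (@leq_trans (kk 1 t.+1)); last by apply: kk_mono; lia.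
by rewrite !kk1 binS bin1.
Qed.

(* At level 0 the hypothesis [t <= kk l s] must be weakened: one nonempty
   shadow set there covers arbitrarily many sets. *)
Lemma kk_step l s t : t <= kk l s \/ (l = 0 /\ (0 < t -> 0 < s)) ->
  kk l.+1 t + t <= kk l.+1 (s + t).
Proof.
elim: l s t => [|l IH] s t H.
  by apply: kk_step0 => t0; case: H => [|[_ ->]]; rewrite // leqNgt t0.
case: H => [H|[//]].
case: (posnP t) => [->|t0]; first by rewrite kk0.
set n := broot l.+1 t.
have nl : l.+2 <= n by apply: broot_max; rewrite binn.
have n_le := broot_le l.+1 t; have n_lt := broot_lt l.+1 t.
rewrite -/n in n_le n_lt.
pose t' := t - 'C(n, l.+2).
have tE : t = 'C(n, l.+2) + t' by rewrite /t'; lia.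
have t'_lt : t' < 'C(n, l.+1) by rewrite binS in n_lt; rewrite /t'; lia.
have s_ge : 'C(n, l.+1) <= s.
  rewrite leqNgt; apply/negP => Hs.
  have := kk_avg (ltnW Hs); have := mul_bin_left n l.+1.
  have : s * (n - l.+1) < 'C(n, l.+1) * (n - l.+1) by rewrite ltn_mul2r; lia.
  nia.
pose s' := s - 'C(n, l.+1).
have sE : s = 'C(n, l.+1) + s' by rewrite /s'; lia.
have tk : kk l.+2 t = 'C(n, l.+3) + kk l.+1 t' by rewrite tE kk_cascade.
(* Truncating [s'] keeps the remainder below ['C(n.+1, l.+1)], so that ['C(n.+1, l.+2)] stays the
   leading term of the cascade. *)
suff K : kk l.+1 t' + t' <= kk l.+1 (minn s' 'C(n, l) + t').
  apply: (@leq_trans (kk l.+2 ('C(n.+1, l.+2) + (minn s' 'C(n, l) + t')))); last first.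
    by apply: kk_mono; rewrite binS; lia.
  rewrite kk_cascade; last by rewrite binS; lia.
  by rewrite tk tE [X in _ <= X + _]binS; lia.
apply: IH; case: (ltnP s' 'C(n, l)) => s'n.
  by left; move: H; rewrite sE tE kk_cascade; lia.
case: (l) t'_lt => [|l' t'_lt]; first by right; rewrite bin0.
by left; rewrite kk_bin ltnW.
Qed.

(** * The Kruskal-Katona theorem *)

Notation setfam := {fset {fset nat}}.

Definition repl (x i : nat) (C : {fset nat}) := x |` (C `\ i).

Lemma replK x i C : x \notin C -> i \in C -> repl i x (repl x i C) = C.
Proof.
move=> xC iC; apply/fsetP => z; rewrite /repl !inE.
have [->|] := eqVneq z i; first by rewrite iC.
by have [->|] := eqVneq z x; rewrite ?(negbTE xC) ?andbF.
Qed.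

Lemma replD1 x i C : x \notin C -> repl x i C `\ x = C `\ i.
Proof.
move=> xC; apply/fsetP => z; rewrite /repl !inE.
by have [->|] := eqVneq z x; rewrite ?(negbTE xC) ?andbF.
Qed.

Lemma replCD1 x i y C : y != x -> repl x i (C `\ y) = repl x i C `\ y.
Proof.
move=> yx; apply/fsetP => z; rewrite /repl !inE.
have [->|] := eqVneq z y; last by [].
by rewrite (negbTE yx) andbF.
Qed.

Lemma in_repl x i C z : x != i -> z \in repl x i C = (z == x) || ((z != i) && (z \in C)).
Proof. by rewrite /repl !inE. Qed.

Definition shift1 (x i : nat) (F : setfam) (C : {fset nat}) :=
  if [&& i \in C, x \notin C & repl x i C \notin F] then repl x i C else C.

Definition shift x i (F : setfam) : setfam := [fset shift1 x i F C | C in F].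

Lemma card_shift x i F : x != i -> #|` shift x i F| = #|` F|.
Proof.
move=> xi; apply: card_in_imfset => C D CF DF; rewrite /shift1.
case: ifP => [/and3P[iC xC CnF]|_]; case: ifP => [/and3P[iD xD DnF]|_] //.
- by move=> E; rewrite -(replK xC iC) E replK.
- by move=> E; rewrite E DF in CnF.
- by move=> E; rewrite -E CF in DnF.
Qed.

Lemma mem_shift x i F C : x != i ->
  (C \in shift x i F) =
    if i \in C then (C \in F) && ((x \in C) || (repl x i C \in F))
    else (C \in F) || ((x \in C) && (repl i x C \in F)).
Proof.
move=> xi; have ix : i != x by rewrite eq_sym.
apply/imfsetP/idP => /= [[D DF ->]|].
  rewrite /shift1; case: (boolP [&& _, _ & _]) => [/and3P[iD xD DnF]|].
    by rewrite !in_repl // !eqxx (negbTE ix) /= replK // DF orbT.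
  by rewrite !negb_and !negbK DF; case: (i \in D).
case: ifP => iC.
  by case/andP=> CF H; exists C => //; rewrite /shift1 iC /=; case: (x \in C) H => //= ->.
case/orP => [CF|/andP[xC CF]]; first by exists C => //; rewrite /shift1 iC.
case CF' : (C \in F); first by exists C => //; rewrite /shift1 iC.
exists (repl i x C) => //; rewrite /shift1 !in_repl // !eqxx (negbTE xi) /=.
by rewrite !replK ?iC // CF'.
Qed.

(* [K] is a common core; [l] counts the elements of [C] outside it, each of
   which can be removed inside [G]. *)
Definition full_over (K : {fset nat}) (l : nat) (F G : setfam) :=
  forall C, C \in F -> [/\ K `<=` C, #|` C `\` K| = l &
    forall y, y \in C -> y \notin K -> C `\ y \in G].

(** The delicate case is a set kept only because its replacement is already in [F]: for each removed
    [y] other than [i], the replacement of [C \ y] is then in [G], so [C \ y] is kept too. *)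
Lemma full_shift K l F G x i : x != i -> x \notin K -> i \notin K ->
  full_over K l F G -> full_over K l (shift x i F) (shift x i G).
Proof.
move=> xi xK iK H C; have ix : i != x by rewrite eq_sym.
rewrite mem_shift //; case: ifP => iC.
  case/andP=> CF HC; have [KC cC CG] := H _ CF; split=> // y yC yK.
  have [yi|yi] := eqVneq y i.
    by rewrite mem_shift // yi fsetD11 -yi CG.
  rewrite mem_shift // !inE eq_sym yi iC /= CG //=.
  have [yx|yx] := eqVneq y x.
    rewrite yx /=; have -> : repl x i (C `\ x) = C `\ i.
      by apply/fsetP => z; rewrite /repl !inE; have [->|] := eqVneq z x; rewrite ?xi -?yx ?yC.
    exact: CG.
  case xC: (x \in C) HC => //= HC.
  rewrite replCD1 //; have [_ _ ->] := H _ HC; rewrite ?orbT //.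
  by rewrite in_repl // yi yC orbT.
case xC: (x \in C) => /=; last first.
  rewrite orbF => CF; have [KC cC CG] := H _ CF; split=> // y yC yK.
  by rewrite mem_shift // !inE iC andbF CG.
case CF: (C \in F) => /=.
  move=> _; have [KC cC CG] := H _ CF; split=> // y yC yK.
  by rewrite mem_shift // !inE iC andbF CG.
move=> RF; have [KC cC CG] := H _ RF; split.
- apply/fsubsetP => z zK; have := fsubsetP KC z zK; rewrite in_repl //.
  have [E|_] := eqVneq z i; first by rewrite E (negbTE iK) in zK.
  by case: (z == x) => //= zx; move: zK; have [->|] := eqVneq z x; rewrite ?(negbTE xK).
- rewrite -cC /repl.
  have E : C `\` K = x |` ((C `\` K) `\ x) by rewrite fsetD1K // !inE xC xK.
  have -> : (i |` C `\ x) `\` K = i |` ((C `\` K) `\ x).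
    apply/fsetP => z; rewrite !inE; have [->|_] := eqVneq z i; first by rewrite iK.
    by rewrite andbCA.
  by rewrite [in LHS]E !cardfsU1 !inE eqxx iC !andbF.
move=> y yC yK; rewrite mem_shift // !inE iC andbF.
have [yx|yx] := eqVneq y x.
  have := CG i; rewrite in_repl // eqxx replD1 ?iC // yx => -> //.
have yi : y != i by apply: contraFneq iC => <-.
rewrite xC /= replCD1 // CG ?orbT //.
by rewrite in_repl // yx yC orbT.
Qed.

Lemma card_fset_predC (T : choiceType) (F : {fset T}) (p : pred T) :
  #|` F| = #|` [fset C in F | p C]| + #|` [fset C in F | ~~ p C]|.
Proof.
rewrite -(cardfsID [fset C in F | p C] F); congr (_ + _); congr (size (enum_fset _));
  apply/fsetP => C.
  by rewrite !inE andbA andbb.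
by rewrite !inE; case: (C \in F); rewrite ?andbF ?andbT.
Qed.

Definition avoid x (F : setfam) : setfam := [fset C in F | x \notin C].
Definition star x (F : setfam) : setfam := [fset C in F | x \in C].

Lemma card_star_avoid x F : #|` F| = #|` star x F| + #|` avoid x F|.
Proof. exact: card_fset_predC. Qed.

Lemma card_star_D1 x F : #|` [fset C `\ x | C in star x F]| = #|` star x F|.
Proof.
apply: card_in_imfset => C D; rewrite !inE => /andP[_ xC] /andP[_ xD] E.
by rewrite -(fsetD1K xC) -(fsetD1K xD) E.
Qed.

Definition stable (K : {fset nat}) x (F : setfam) := forall C i, C \in F -> x \notin C ->
  i \in C ->
  i \notin K -> repl x i C \in F.

(** Each shift that changes [F] turns a set avoiding [x] into one containing it, so [avoid x F]
    strictly shrinks. *)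
Lemma stabilize K l x F G : x \notin K -> full_over K l F G ->
  exists F' G', [/\ full_over K l F' G', #|` F'| = #|` F|, #|` G'| = #|` G| & stable K x F'].
Proof.
move=> xK; have [n] := ubnP #|` avoid x F|; elim: n F G => // n IH F G le_n H.
have [/existsP[[D DF] /existsP[[i /= iD] /and3P[/= xD iK RF]]]|st] :=
  boolP [exists C : F, exists i : val C,
    [&& x \notin val C, val i \notin K & repl x (val i) (val C) \notin F]].
  have xi : x != i by apply: contraNneq xD => ->.
  have [||F' [G' [H' c1 c2 st]]] := IH (shift x i F) (shift x i G).
  - rewrite -ltnS; apply: leq_trans le_n; rewrite ltnS; apply: fproper_ltn_card.
    rewrite fproperE; apply/andP; split.
      apply/fsubsetP => E; rewrite !inE mem_shift // => /andP[].
      by move=> + xE; rewrite xE (negbTE xE) andbT orbF; case: ifP => _ // /andP[].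
    apply/fsubsetPn; exists D; first by rewrite !inE xD DF.
    by rewrite !inE mem_shift // iD (negbTE xD) (negbTE RF) !andbF.
  - exact: full_shift.
  by exists F', G'; rewrite c1 c2 !card_shift.
exists F, G; split => // C i CF xC iC iK; apply: contraNT st => RF.
by apply/existsP; exists [` CF]; apply/existsP; exists [` iC]; rewrite /= xC iK RF.
Qed.

Lemma fset_neq0P (T : choiceType) (F : {fset T}) : 0 < #|` F| -> exists C, C \in F.
Proof. by rewrite cardfs_gt0 => /fset0Pn. Qed.

Definition kk_bound l t s := t <= kk l s \/ (l = 0 /\ (0 < t -> 0 < s)).

(* After shifting towards a fixed [x], the sets avoiding [x] have their shadow
   among the sets [C `\ x] with [x \in C], so no choice of [x] is needed. *)
Lemma kk_full0 K l F G : full_over K l.+1 F G -> kk_bound l #|` F| #|` G|.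
Proof.
elim: l K F G => [|l IHl] K F G.
  move=> H; right; split=> // /fset_neq0P[C CF].
  have [_ c1 CG] := H _ CF; have /fset_neq0P[y] : 0 < #|` C `\` K| by rewrite c1.
  by rewrite inE => /andP[yK yC]; rewrite cardfs_gt0; apply/fset0Pn; exists (C `\ y);
    apply: CG.
move=> H; left; have [n] := ubnP #|` F|; elim: n F G H => // n IHn F0 G0 H0 le_n.
case: (posnP #|` F0|) => [-> //|F0_gt0].
have [x xK] : exists x, x \notin K.
  have /fset_neq0P[C CF] := F0_gt0; have [_ cC _] := H0 _ CF.
  have /fset_neq0P[x] : 0 < #|` C `\` K| by rewrite cC.
  by rewrite inE => /andP[xK _]; exists x.
have [F [G [H cF cG st]]] := stabilize xK H0.
rewrite -cF -cG; rewrite -{}cF in le_n F0_gt0.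
have {F0_gt0} : 0 < #|` star x F|.
  have /fset_neq0P[C CF] := F0_gt0.
  have [xC|xC] := boolP (x \in C); first by rewrite cardfs_gt0; apply/fset0Pn; exists C;
    rewrite !inE CF.
  have [_ c2 _] := H _ CF; have /fset_neq0P[i] : 0 < #|` C `\` K| by rewrite c2.
  rewrite inE => /andP[iK iC]; rewrite cardfs_gt0; apply/fset0Pn; exists (repl x i C).
  by rewrite !inE (st _ _ CF xC iC iK) eqxx.
move=> star_gt0; rewrite (card_star_avoid x F).
set G' : setfam := [fset C `\ x | C in star x F].
have cG' : #|` G'| = #|` star x F| by apply: card_star_D1.
have Hav : full_over K l.+2 (avoid x F) G'.
  move=> C; rewrite !inE => /andP[CF xC]; have [KC cC CG] := H _ CF; split=> // y yC yK.
  apply/imfsetP; exists (repl x y C) => /=; first by rewrite !inE (st _ _ CF xC yC yK) eqxx.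
  by rewrite replD1.
have Hstar : full_over (x |` K) l.+1 (star x F) (star x G).
  move=> C; rewrite !inE => /andP[CF xC]; have [KC cC CG] := H _ CF; split.
  - by rewrite fsubUset fsub1set xC.
  - apply: succn_inj; rewrite -cC [in RHS](cardfsD1 x) !inE xC xK /=; congr _.+1;
    congr (size (enum_fset _)).
    by apply/fsetP => z; rewrite !inE negb_or; rewrite andbA.
  move=> y yC; rewrite !inE negb_or => /andP[yx yK].
  by rewrite CG // eq_sym yx.
have G'G : G' `<=` avoid x G.
  apply/fsubsetP => _ /imfsetP[C /= + ->]; rewrite !inE => /andP[CF xC]; rewrite eqxx andbT.
  by have [_ _ ->] := H _ CF.
have IHs := IHl _ _ _ Hstar.
have IHa : #|` avoid x F| <= kk l.+1 #|` G'|.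
  by apply: IHn Hav _; have := card_star_avoid x F; lia.
(* [kk_step] is used with [t = #|star x F|], which is also the size of the subfamily [G'] of
   [avoid x G]. *)
apply: (@leq_trans (kk l.+1 (#|` star x G| + #|` star x F|))).
  by apply: leq_trans (kk_step IHs); rewrite addnC leq_add2r -cG'.
by apply: kk_mono; rewrite (card_star_avoid x G) leq_add2l -cG' fsubset_leq_card.
Qed.

Lemma kk_full K l F G : 0 < l -> full_over K l.+1 F G -> #|` F| <= kk l #|` G|.
Proof. by move=> l0 /kk_full0[//|[l1 _]]; rewrite l1 in l0. Qed.

(** * Splitting a family by an element *)

Lemma card_fset_sum (T : choiceType) (Q : {fset T}) (p : pred T) :
  #|` [fset x in Q | p x]| = \sum_(x <- Q) p x.
Proof.
rewrite -(@perm_size _ (filter p Q)); first by rewrite size_filter -sum1_count big_mkcond.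
apply: uniq_perm; rewrite ?filter_uniq ?fset_uniq // => x.
by rewrite mem_filter !inE andbC.
Qed.

Lemma double_count (T1 T2 : choiceType) (P : {fset T1}) (Q : {fset T2}) (r : T1 -> T2 ->
  bool) a c :
  (forall p, p \in P -> a <= #|` [fset q in Q | r p q]|) ->
  (forall q, q \in Q -> #|` [fset p in P | r p q]| <= c) ->
  a * #|` P| <= c * #|` Q|.
Proof.
move=> HP HQ; rewrite !card_fset_sum1 !big_distrr /= !muln1.
apply: (@leq_trans (\sum_(p <- P) \sum_(q <- Q) r p q)).
  rewrite big_seq [leqRHS]big_seq; apply: leq_sum => p pP.
  by rewrite -card_fset_sum HP.
rewrite exchange_big /= big_seq [leqRHS]big_seq; apply: leq_sum => q qQ.
by rewrite -card_fset_sum HQ.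
Qed.

Lemma card_subset_preds (F : setfam) (Y : {fset nat}) m : #|` Y| = m ->
  (forall Z, Z \in F -> #|` Z|.+1 = m) -> #|` [fset Z in F | Z `<=` Y]| <= m.
Proof.
move=> cY HF; rewrite -cY.
apply: (@leq_trans #|` [fset Y `\ y | y in Y]|); last by apply: leq_imfset_card.
apply: fsubset_leq_card; apply/fsubsetP => Z; rewrite !inE => /andP[ZF ZY].
have /fset_neq0P[y] : 0 < #|` Y `\` Z| by rewrite cardfsDS // cY -(HF _ ZF); lia.
rewrite inE => /andP[yZ yY]; apply/imfsetP; exists y => //=.
apply/eqP; rewrite eqEfcard; apply/andP; split; first by rewrite fsubsetD1 ZY.
by have := cardfsD1 y Y; rewrite yY cY -(HF _ ZF); lia.
Qed.

Lemma cover_eq (R C : {fset nat}) y : R `<=` C -> #|` C| = #|` R|.+1 ->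
  y \in C `\` R -> C = y |` R.
Proof.
move=> RC cC; rewrite inE => /andP[yR yC]; apply/esym/eqP.
by rewrite eqEfcard fsubUset fsub1set yC RC cardfsU1 yR cC /=.
Qed.

Lemma card_supsets (F : setfam) (R B : {fset nat}) :
  (forall C, C \in F -> #|` C| = #|` R|.+1) ->
  #|` [fset C in F | (R `<=` C) && (C `\` R `<=` B)]| <= #|` B `\` R|.
Proof.
move=> HF.
apply: (@leq_trans #|` [fset y |` R | y in B `\` R]|); last by apply: leq_imfset_card.
apply: fsubset_leq_card; apply/fsubsetP => C; rewrite !inE => /and3P[CF RC CB].
have /fset_neq0P[y] : 0 < #|` C `\` R| by rewrite cardfsDS // HF //; lia.
move=> yCR; apply/imfsetP; exists y => /=.
  by have := fsubsetP CB _ yCR; move: yCR; rewrite !inE => /andP[-> _] ->.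
exact: cover_eq (HF _ CF) yCR.
Qed.

(** * Removable elements, minimum degree and the crude bound *)

Definition removable (G : setfam) (C : {fset nat}) := [fset x in C | C `\ x \in G].
Definition adm k (F G : setfam) := forall C, C \in F -> k <= #|` removable G C|.
Definition unif r (F G : setfam) :=
  (forall C, C \in F -> #|` C| = r.+1) /\ (forall B, B \in G -> #|` B| = r).
Definition supersets B (F : setfam) : setfam := [fset C in F | B `<=` C].

(* Walking up and down from [B0], with every step down removing an element of
   [B0], reaches many members of [G], told apart by their traces outside [B0]. *)
Section MinDegree.
Variables (j r D : nat) (F G : setfam) (B0 : {fset nat}).
Hypotheses (HU : unif r F G) (HA : adm j.+1 F G) (B0G : B0 \in G).
Hypothesis HD : forall B, B \in G -> D < #|` supersets B F|.

Let traces i : setfam := [fset R `\` B0 | R in [fset R in G | #|` R `\` B0| == i]].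

Lemma tracesP i Y : reflect (exists R, [/\ R \in G, #|` R `\` B0| = i & Y = R `\` B0]) (Y \in traces i).
Proof.
apply: (iffP (imfsetP _ _ _ _)) => /= [[R + ->]|[R [RG c ->]]].
  by rewrite !inE => /andP[RG /eqP c]; exists R.
by exists R => //; rewrite !inE RG c eqxx.
Qed.

(** At most [i] of the supersets of [R] add an element of [B0]; the others have distinct traces of
    size [i.+1]. Such a superset has at least [j.+1] removable elements and only [i.+1 <= j]
    elements outside [B0], so some removable one lies in [B0], and removing it keeps the trace. *)
Lemma traces_step i : i < j -> (D - j) * #|` traces i| <= i.+1 * #|` traces i.+1|.
Proof.
move=> ij; apply: (double_count (r := fun Y Y' : {fset nat} => Y `<=` Y')).
  move=> _ /tracesP[R [RG cR ->]].
  have cB0R : #|` B0 `\` R| = i.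
    have := cardfsID R B0; have := cardfsID B0 R; rewrite fsetIC.
    by rewrite (HU.2 _ RG) (HU.2 _ B0G) cR; lia.
  have := HD RG; rewrite (card_fset_predC _ (fun C => C `\` R `<=` B0)).
  have le1 := @card_supsets F R B0 (fun C CF =>
    etrans (HU.1 C CF) (congr1 S (esym (HU.2 _ RG)))).
  set E := [fset C in supersets R F | ~~ _].
  have -> : [fset C in supersets R F | C `\` R `<=` B0] = [fset C in F | (R `<=` C) && (C `\` R `<=` B0)].
    by apply/fsetP => C; rewrite !inE andbA.
  move=> lt1; apply: (@leq_trans #|` E|); first by rewrite cB0R in le1; lia.
  have sucR C : C \in F -> #|` C| = #|` R|.+1 by move=> CF; rewrite (HU.1 _ CF) (HU.2 _ RG).
  have key C : C \in E -> C = R `|` (C `\` B0).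
    rewrite !inE => /andP[/andP[CF RC] nCB]; have [y yCR yB0] := fsubsetPn _ _ nCB.
    rewrite [in LHS](cover_eq RC (sucR _ CF) yCR) [in RHS](cover_eq RC (sucR _ CF) yCR).
    apply/fsetP => z; rewrite !inE; have [->|_] := eqVneq z y; rewrite /= ?yB0 ?orbT //.
    by case: (z \in R); rewrite /= ?andbF.
  have <- : #|` [fset C `\` B0 | C in E]| = #|` E|.
    by apply: card_in_imfset => C C' CE CE' E1; rewrite (key C) // (key C') // E1.
  apply: fsubset_leq_card; apply/fsubsetP => _ /imfsetP[C /= + ->].
  rewrite !inE => /andP[/andP[CF RC] nCB]; rewrite (fsetSD _ RC) andbT.
  have [y yCR yB0] := fsubsetPn _ _ nCB.
  have CE := cover_eq RC (sucR _ CF) yCR.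
  have cC : #|` C `\` B0| = i.+1.
    move: yCR; rewrite inE => /andP[yR yC].
    rewrite CE; have -> : (y |` R) `\` B0 = y |` (R `\` B0).
      by apply/fsetP => z; rewrite !inE; have [->|_] := eqVneq z y; rewrite ?yB0.
    by rewrite cardfsU1 cR !inE (negbTE yR) andbF.
  have /fset_neq0P[z] : 0 < #|` removable G C `\` (C `\` B0)|.
    have := HA CF; have := cardfsID (C `\` B0) (removable G C).
    by have := fsubset_leq_card (fsubsetIr (removable G C) (C `\` B0)); lia.
  rewrite !inE => /andP[zB0 /andP[zC CzG]].
  have {}zB0 : z \in B0 by move: zB0; rewrite zC andbT negbK.
  have E1 : (C `\ z) `\` B0 = C `\` B0.
    by apply/fsetP => u; rewrite !inE; have [->|] := eqVneq u z; rewrite ?zB0.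
  by apply/tracesP; exists (C `\ z); rewrite E1.
move=> _ /tracesP[R [RG cR ->]]; apply: card_subset_preds => // Z /tracesP[R' [_ cR' ->]].
by rewrite cR'.
Qed.

Lemma mindeg : (D - j) ^ j <= j`! * #|` G|.
Proof.
have H i : i <= j -> (D - j) ^ i <= i`! * #|` traces i|.
  elim: i => [_|i IH ij].
    rewrite expn0 fact0 mul1n cardfs_gt0; apply/fset0Pn; exists fset0.
    by apply/tracesP; exists B0; rewrite fsetDv cardfs0.
  have := traces_step ij; have := IH (ltnW ij).
  by rewrite expnS factS; nia.
apply: leq_trans (H j (leqnn _)) _; rewrite leq_mul2l; apply/orP; right.
apply: leq_trans (leq_imfset_card _ _ _) _; apply: fsubset_leq_card.
by apply/fsubsetP => R; rewrite !inE => /andP[].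
Qed.
End MinDegree.

Lemma unif_sub r F G F' G' : F' `<=` F -> G' `<=` G -> unif r F G -> unif r F' G'.
Proof. by move=> /fsubsetP FF /fsubsetP GG [H1 H2]; split=> C ?;
  [apply/H1/FF | apply/H2/GG]. Qed.

Lemma adm0 k F : adm k.+1 F fset0 -> F = fset0.
Proof.
move=> H; apply/eqP; apply: contraT => /fset0Pn[C CF].
have /fset_neq0P[x] : 0 < #|` removable fset0 C| by apply: leq_trans (H _ CF).
by rewrite !inE andbF.
Qed.

(** Members of [G] with at most [D] supersets are deleted one at a time, together with those
    supersets. A surviving set does not contain the deleted [B], so it loses no removable element.
    When no such member is left, [mindeg] would make [G] too large. *)
Lemma crude j r D F G : unif r F G -> adm j.+1 F G -> j`! * #|` G| < (D - j) ^ j ->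
  #|` F| <= D * #|` G|.
Proof.
have [n] := ubnP #|` G|; elim: n F G => // n IH F G le_n HU HA HD.
have [/existsP[[B /= BG] degB]|no] := boolP [exists B : G, #|` supersets (val B) F| <= D].
  have cG := cardfsD1 B G; rewrite BG in cG.
  rewrite (card_fset_predC F (fun C => B `<=` C)) cG mulnDr muln1; apply: leq_add => //.
  apply: IH; first by rewrite cG in le_n; lia.
  - by apply: unif_sub HU; apply/fsubsetP => C; rewrite !inE => /andP[].
  - move=> C; rewrite !inE => /andP[CF nBC]; apply: leq_trans (HA _ CF) _.
    apply: fsubset_leq_card; apply/fsubsetP => x; rewrite !inE => /andP[-> ->];
      rewrite andbT /=.
    by apply: contraNneq nBC => <-; rewrite fsubsetDl.
  by apply: leq_ltn_trans HD; rewrite leq_mul2l cG; lia.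
have [G0|[B BG]] := fset_0Vmem G.
  by rewrite G0 in HA; rewrite (adm0 HA) cardfs0.
suff : (D - j) ^ j <= j`! * #|` G| by lia.
apply: (mindeg HU HA BG) => B' BG'; rewrite ltnNge; apply: contra no => H.
by apply/existsP; exists [` BG'].
Qed.

Lemma star_sub x F : star x F `<=` F.
Proof. by apply/fsubsetP => C; rewrite !inE => /andP[]. Qed.

Lemma avoid_sub x F : avoid x F `<=` F.
Proof. by apply/fsubsetP => C; rewrite !inE => /andP[]. Qed.

(** Restricting [G] to [star x G] can cost a set [C] through [x] only the removable element [x]
    itself. If [C] drops below [k], then [C \ x] lies in [avoid x G] and determines [C]. *)
Lemma split_family k r F G x : unif r F G -> adm k F G ->
  exists F1 F2, [/\ unif r F1 (star x G) /\ adm k F1 (star x G),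
    unif r F2 (avoid x G) /\ adm k F2 (avoid x G) &
    #|` F| <= #|` F1| + #|` F2| + #|` avoid x G|].
Proof.
move=> HU HA; set F1 := [fset C in star x F | k <= #|` removable (star x G) C|].
exists F1, (avoid x F); split.
- split; last by move=> C; rewrite inE => /andP[].
  apply: unif_sub HU; rewrite ?star_sub //.
  by apply/fsubsetP => C; rewrite !inE => /andP[/andP[]].
- split; first by apply: unif_sub HU; rewrite avoid_sub.
  move=> C; rewrite !inE => /andP[CF xC]; apply: leq_trans (HA _ CF) _.
  apply: fsubset_leq_card; apply/fsubsetP => y; rewrite !inE => /andP[-> ->] /=.
  by rewrite (negbTE xC) andbF.
rewrite (card_star_avoid x F) (card_fset_predC (star x F) (fun C =>
  k <= #|` removable (star x G) C|)) -/F1.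
rewrite [leqRHS]addnAC leq_add2r leq_add2l.
have <- : #|` [fset C `\ x | C in [fset C in star x F | ~~ (k <= #|` removable (star x G) C|)]]| =
  #|` [fset C in star x F | ~~ (k <= #|` removable (star x G) C|)]|.
  apply: card_in_imfset => C D; rewrite !inE => /andP[/andP[_ xC] _] /andP[/andP[_ xD] _] E.
  by rewrite -(fsetD1K xC) -(fsetD1K xD) E.
apply: fsubset_leq_card; apply/fsubsetP => _ /imfsetP[C /= + ->].
rewrite !inE eqxx /= andbT => /andP[/andP[CF xC]]; apply: contraR => CxG.
apply: leq_trans (HA _ CF) _; apply: fsubset_leq_card; apply/fsubsetP => y.
rewrite !inE => /andP[yC CyG]; rewrite yC CyG xC andbT.
by apply: contraNneq CxG => ->.
Qed.

(** * Families that no element splits usefully *)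

Lemma removable_star G C x : x \in C -> removable (star x G) C = removable G C `\ x.
Proof.
move=> xC; apply/fsetP => y; rewrite !inE xC andbT [x == y]eq_sym.
by case: (y == x); case: (y \in C); rewrite ?andbF ?andbT.
Qed.

(** If no element splits, every [x] outside the core [K] of [G] lies in few members, so [crude]
    bounds [F2 x] by [D * #|star x G|]. Each [C] lies in [F2 x] for at least [m] such [x]: any [x]
    in [C \ K] if [C] has a spare removable element, otherwise any [x] there that is not
    removable. *)
Lemma spread_families j r F G D th : 0 < j -> unif r F G -> adm j.+1 F G ->
  (forall p, p < th -> j`! * p < (D - j) ^ j) ->
  [\/ exists2 x, th <= #|` star x G| & 0 < #|` avoid x G|,
     #|` F| <= j.+1 * D * #|` G| | #|` F| <= kk j #|` G|].
Proof.
move=> j_gt0 HU HA HD.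
have [G0|[B0 B0G]] := fset_0Vmem G.
  by rewrite G0 in HA; rewrite (adm0 HA) cardfs0; constructor 2.
have [F0|[C0 C0F]] := fset_0Vmem F; first by rewrite F0 cardfs0; constructor 2.
set V := \bigcup_(C <- F) C.
have VP C x : C \in F -> x \in C -> x \in V.
  by move=> CF; apply/fsubsetP; apply: bigfcup_sup.
have [/hasP[x _ /andP[H1 H2]]|/hasPn no] :=
  boolP (has (fun x => (th <= #|` star x G|) && (0 < #|` avoid x G|)) V).
  by constructor 1; exists x.
pose K : {fset nat} := [fset x in B0 | #|` avoid x G| == 0].
have KE x : (x \in K) = (x \in B0) && (#|` avoid x G| == 0) by rewrite !inE.
move: K KE => K KE.
have KB x B : x \in K -> B \in G -> x \in B.
  rewrite KE => /andP[_ /eqP/cardfs0_eq/fsetP avG] BG; have := avG B.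
  by rewrite !inE BG => /negbFE.
have topK C x : x \in removable G C -> x \notin K.
  by rewrite inE => /andP[xC CxG]; apply/negP => xK; have := KB _ _ xK CxG; rewrite !inE eqxx.
have KC C : C \in F -> K `<=` C.
  move=> CF; have /fset_neq0P[y] : 0 < #|` removable G C| by apply: leq_trans (HA _ CF).
  rewrite !inE => /andP[yC CyG]; apply/fsubsetP => x xK; have := KB _ _ xK CyG.
  by rewrite !inE => /andP[].
have topC C : C \in F -> removable G C `<=` C `\` K.
  move=> CF; apply/fsubsetP => x xt; rewrite inE (topK _ _ xt).
  by move: xt; rewrite inE => /andP[].
have cCK C : C \in F -> #|` C `\` K| = r.+1 - #|` K|.
  by move=> CF; rewrite cardfsDS ?KC // (HU.1 _ CF).
have le_j : j.+1 <= r.+1 - #|` K|.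
  by rewrite -(cCK _ C0F); apply: leq_trans (HA _ C0F) (fsubset_leq_card (topC _ C0F)).
have [E|N] := eqVneq (r.+1 - #|` K|) j.+1.
  constructor 3; apply: (@kk_full K) => // C CF.
  have cC : #|` C `\` K| = j.+1 by rewrite cCK.
  split=> //; first exact: KC.
  move=> y yC yK.
  have : y \in removable G C.
    have /eqP -> : removable G C == C `\` K by rewrite eqEfcard topC //= cC HA.
    by rewrite inE yK.
  by rewrite inE => /andP[].
constructor 2; set m := r.+1 - #|` K| - j.+1.
have m_gt0 : 0 < m by rewrite /m; lia.
pose F2 x : setfam := [fset C in star x F | j.+1 <= #|` removable (star x G) C|].
have le1 : m * #|` F| <= \sum_(x <- V | x \notin K) #|` F2 x|.
  rewrite card_fset_sum1 big_distrr /= muln1.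
  apply: (@leq_trans (\sum_(C <- F) \sum_(x <- V | x \notin K) (C \in F2 x))).
    rewrite big_seq [leqRHS]big_seq; apply: leq_sum => C CF.
    have -> : \sum_(x <- V | x \notin K) (C \in F2 x) =
        #|` [fset x in V | (x \notin K) && (C \in F2 x)]|.
      by rewrite card_fset_sum big_mkcond; apply: eq_bigr => x _; case: (x \notin K).
    have [c1|c1] := eqVneq #|` removable G C| j.+1.
      have -> : m = #|` (C `\` K) `\` removable G C|.
        by rewrite cardfsDS ?topC // cCK // c1.
      apply: fsubset_leq_card; apply/fsubsetP => x; rewrite inE => /andP[xt].
      rewrite !inE => /andP[xK xC]; rewrite (VP C) // CF xC xK /=.
      by rewrite removable_star // mem_fsetD1 // c1.
    apply: (@leq_trans #|` C `\` K|); first by rewrite cCK //; exact: leq_subr.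
    apply: fsubset_leq_card; apply/fsubsetP => x; rewrite inE => /andP[xK xC].
    rewrite !inE (VP C) // CF xC xK /= removable_star //.
    have E := cardfsD1 x (removable G C); have lt := HA _ CF;
      have b1 := leq_b1 (x \in removable G C).
    rewrite -ltnS; apply: (@leq_trans #|` removable G C|);
      first by rewrite ltn_neqAle eq_sym c1.
    by rewrite E -[leqRHS]add1n leq_add2r.
  rewrite exchange_big /=; apply: leq_sum => x _; rewrite -card_fset_sum.
  by apply: fsubset_leq_card; apply/fsubsetP => C; rewrite inE => /andP[].
have le2 : \sum_(x <- V | x \notin K) #|` F2 x| <= D * (#|` G| * (r - #|` K|)).
  apply: (@leq_trans (\sum_(x <- V | x \notin K) D * #|` star x G|)).
    rewrite big_seq_cond [leqRHS]big_seq_cond; apply: leq_sum => x /andP[xV xK].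
    apply: (@crude j r).
    - apply: unif_sub HU; rewrite ?star_sub //.
      by apply/fsubsetP => C; rewrite !inE => /andP[/andP[]].
    - by move=> C; rewrite inE => /andP[].
    apply: HD; rewrite ltnNge; apply/negP => lt1; have := no _ xV;
      rewrite lt1 /= -eqn0Ngt => av0.
    move: xK; rewrite KE av0 andbT; move/eqP/cardfs0_eq/fsetP/(_ B0): av0.
    by rewrite !inE B0G => /negbFE ->.
  rewrite -big_distrr leq_mul2l; apply/orP; right.
  rewrite [#|` G|]card_fset_sum1 big_distrl /=.
  apply: (@leq_trans (\sum_(B <- G) \sum_(x <- V | x \notin K) (x \in B))).
    by rewrite exchange_big /=; apply: leq_sum => x _; rewrite card_fset_sum.
  rewrite big_seq [leqRHS]big_seq; apply: leq_sum => B BG; rewrite mul1n.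
  have -> : \sum_(x <- V | x \notin K) (x \in B) = #|` [fset x in V | (x \notin K) && (x \in B)]|.
    by rewrite card_fset_sum big_mkcond; apply: eq_bigr => x _; case: (x \notin K).
  have <- : #|` B `\` K| = r - #|` K|.
    by rewrite cardfsDS ?(HU.2 _ BG) //; apply/fsubsetP => x xK; apply: KB.
  apply: fsubset_leq_card; apply/fsubsetP => x; rewrite !inE => /and3P[_ -> ->] //.
have := leq_trans le1 le2.
have -> : r - #|` K| = m + j by rewrite /m; lia.
move=> H; rewrite -(leq_pmul2l m_gt0); apply: leq_trans H _.
(* Since [m] is positive, the factor [r - |K| = m + j] is at most [j.+1 * m]; this removes the
   dependence on [r]. *)
have : m + j <= j.+1 * m by nia.
by move=> /(leq_mul (leqnn (D * #|` G|))); lia.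
Qed.

(** Hiding [r] makes every later bound uniform in it and lets parts of a split re-enter the
    induction. *)
Definition achievable j b a :=
  exists r F G, [/\ unif r F G, adm j.+1 F G, #|` G| = b & #|` F| = a].

Lemma achievable_crude j b a D : achievable j b a -> j`! * b < (D - j) ^ j -> a <= D * b.
Proof. by move=> [r [F [G [HU HA <- <-]]]]; apply: crude HU HA. Qed.

Lemma achievable_split j b a D th : 0 < j -> achievable j b a ->
  (forall p, p < th -> j`! * p < (D - j) ^ j) ->
  [\/ exists s t a1 a2, [/\ b = s + t, 0 < t & th <= s] /\
       [/\ achievable j s a1, achievable j t a2 & a <= a1 + a2 + t],
     a <= j.+1 * D * b | a <= kk j b].
Proof.
move=> j_gt0 [r [F [G [HU HA <- <-]]]] HD.
have [[x x1 x2]|H|H] := spread_families j_gt0 HU HA HD;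
  [constructor 1|by constructor 2|by constructor 3].
have [F1 [F2 [[U1 A1] [U2 A2] le]]] := split_family x HU HA.
exists #|` star x G|, #|` avoid x G|, #|` F1|, #|` F2|; rewrite -card_star_avoid; split=> //.
by split=> //; [exists r, F1, (star x G) | exists r, F2, (avoid x G)].
Qed.

(** * Asymptotic and tight bounds *)

Lemma leq_expl m n e : m <= n -> m ^ e <= n ^ e.
Proof. by case: e => // e; rewrite leq_exp2r. Qed.

Lemma fact_bin_le n j : j`! * 'C(n, j) <= n ^ j.
Proof.
rewrite mulnC bin_ffact; elim: j n => [|j IH] n; first by rewrite ffactn0.
rewrite ffactnS expnS leq_mul2l; apply/orP; right; apply: leq_trans (IH _) _.
by rewrite leq_expl // leq_pred.
Qed.

Lemma croot_ex j p : exists D, (j == 0) || (j`! * p < (D - j) ^ j).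
Proof.
case: j => [|j]; first by exists 0.
exists (j.+1 + (j.+1`! * p).+1); rewrite addKn /= expnS.
by apply: leq_trans (leq_pmulr _ _); rewrite ?expn_gt0.
Qed.

(* Of order p^(1/j); the disjunct [j == 0] in [croot_ex] only makes it total. *)
Definition croot j p := ex_minn (croot_ex j p).

Lemma croot_lt j p : 0 < j -> j`! * p < (croot j p - j) ^ j.
Proof. by rewrite /croot; case: ex_minnP => D; rewrite eqn0Ngt => /orP[/negbTE->|]. Qed.

Lemma croot_le j p D : j`! * p < (D - j) ^ j -> croot j p <= D.
Proof. by move=> H; rewrite /croot; case: ex_minnP => m _; apply; rewrite H orbT. Qed.

Lemma croot_mono j p q : 0 < j -> p <= q -> croot j p <= croot j q.
Proof.
move=> j0 pq; apply: croot_le; apply: leq_ltn_trans (croot_lt q j0).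
by rewrite leq_mul2l pq orbT.
Qed.

(** The factor [2 * N] in place of [N] pays for rounding [n / N] down and for the shift by [j]
    inside [croot]. *)
Lemma croot_bound j N n p : 0 < N -> 2 * N * j.+1 <= n -> j`! * p * (2 * N) ^ j < n ^ j ->
  N * croot j p <= n.
Proof.
move=> N0 Nn H; have := leq_divM n N; have D := divn_eq n N; have lt := ltn_pmod n N0.
move=> le; rewrite mulnC; apply: leq_trans le; rewrite leq_mul2r; apply/orP; right.
apply: croot_le; set d := n %/ N - j.
have le : n <= 2 * N * d by rewrite /d mulnBr; nia.
have /leq_expl-/(_ j) := le; rewrite expnMn => le'.
rewrite -(@ltn_pmul2r ((2 * N) ^ j)) ?expn_gt0 ?muln_gt0 ?N0 //.
by apply: leq_trans H _; rewrite mulnC.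
Qed.

Lemma achievable_croot j b a : 0 < j -> achievable j b a -> a <= croot j b * b.
Proof. by move=> j0 H; apply: achievable_crude H (croot_lt _ _). Qed.

(** Each Pascal increment between [m] and [N] is at most ['C(N.-1, j.-1)], which is the fraction
    [j / N] of ['C(N, j)]. *)
Lemma bin_growth m N j : m <= N -> 0 < j ->
  N * 'C(N, j) <= N * 'C(m, j) + j * (N - m) * 'C(N, j).
Proof.
case: j => // j mN _; rewrite -(subnKC mN) addKn.
have key d : 'C(m + d, j.+1) <= 'C(m, j.+1) + d * 'C((m + d).-1, j).
  elim: d => [|d IH]; first by rewrite addn0 leq_addr.
  rewrite addnS /= binS; apply: (@leq_trans ('C(m, j.+1) + d * 'C(m + d, j) + 'C(m + d, j))).
    rewrite leq_add2r; apply: leq_trans IH _; rewrite leq_add2l leq_mul2l.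
    by apply/orP; right; apply: leq_bin2l; apply: leq_pred.
  by rewrite mulSn; lia.
set d := N - m; have := key d; case E : (m + d) => [|n] //=.
move/(leq_mul (leqnn n.+1)) => H; apply: leq_trans H _.
by rewrite mulnDr leq_add2l mulnCA mul_bin_diag mulnCA mulnA.
Qed.

Lemma bin_succ_le2 m c j : 0 < j -> m <= c.+1 -> 2 * j * (c.+1 - m) <= c.+1 ->
  'C(c.+1, j) <= 2 * 'C(m, j).
Proof. by move=> j0 mc H; have := bin_growth mc j0; nia. Qed.

(** A split may cut [t] members, at cost [j.+1 * t]. The part holding at most half of the sets has
    its root reduced by the fraction 1/(4j), and this saving covers the cost: directly if that part
    is [t], and in [split_gain_l] through the lower threshold on [s]. *)
Lemma split_gain_r j s t c rs rt : c <= 4 * j * (c - rt) -> 4 * j * j.+1 <= c -> 0 < j ->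
  rs <= c -> rt <= c -> s * rs + t * rt + j.+1 * t <= (s + t) * c.
Proof.
move=> H1 H2 j0 rsc rtc; have H : j.+1 <= c - rt.
  by rewrite -(@leq_pmul2l (4 * j)) ?muln_gt0 // (leq_trans H2).
have -> : (s + t) * c = s * c + t * (rt + (c - rt)) by rewrite subnKC // mulnDl.
have := leq_mul (leqnn s) rsc; have := leq_mul (leqnn t) H; lia.
Qed.

Lemma split_gain_l j s t c rs rt : c <= 4 * j * (c - rs) -> 4 * j * j.+1 * (s + t) <= s * c ->
  0 < j -> rs <= c -> rt <= c -> s * rs + t * rt + j.+1 * t <= (s + t) * c.
Proof.
move=> H1 H2 j0 rsc rtc; have H : j.+1 * t <= s * (c - rs).
  rewrite -(@leq_pmul2l (4 * j)) ?muln_gt0 //.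
  apply: (@leq_trans (s * c)); last by rewrite mulnCA leq_mul2l H1 orbT.
  by apply: leq_trans H2; rewrite mulnA leq_mul2l leq_addl orbT.
have -> : (s + t) * c = s * (rs + (c - rs)) + t * c by rewrite subnKC // mulnDl.
have := leq_mul (leqnn t) rtc; lia.
Qed.

Lemma leq_mul_ltn_divLR m d s : 0 < d -> m %/ d < s -> m <= s * d.
Proof. by move=> d0; rewrite ltn_divLR // => /ltnW. Qed.

Section Bounds.
Variable i : nat.
Local Notation j := i.+1.

Lemma broot_half b p : 2 * p <= b -> 4 * j <= broot i b ->
  broot i b <= 4 * j * (broot i b - broot i p).
Proof.
move=> pb; have := broot_lt i b; set c := broot i b => bc jc.
have pc : broot i p <= c by apply: broot_mono; lia.
have := broot_le i p; move: pc; set m := broot i p => mc mp.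
rewrite leqNgt; apply/negP => H.
have : 'C(c.+1, j) <= 2 * 'C(m, j) by apply: bin_succ_le2 => //; nia.
by lia.
Qed.

Lemma fact_broot b : 0 < broot i b -> j`! * b < (2 * broot i b) ^ j.
Proof.
move=> c0; have := fact_bin_le (broot i b).+1 j; have := broot_lt i b => H1 H2.
apply: (@leq_trans ((broot i b).+1 ^ j)); last by apply: leq_expl; lia.
by apply: leq_trans H2; rewrite ltn_pmul2l ?fact_gt0.
Qed.

(** With [c = broot i b], [b] has order c^j, so the quotient has order c^(j-1) and its j-th root is
    negligible against [c]. *)
Lemma croot_quot N M b : 0 < N -> 2 * N * j.+1 <= broot i b -> M * (4 * N) ^ j < broot i b ->
  N * croot j (M * b %/ broot i b) <= broot i b.
Proof.
set c := broot i b => N0 Nc Mc; have c0 : 0 < c by lia.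
apply: croot_bound => //; rewrite -(ltn_pmul2r c0) -expnSr.
have := leq_divM (M * b) c; set p := _ %/ c => pc.
apply: (@leq_ltn_trans (j`! * (M * b) * (2 * N) ^ j)).
  by rewrite mulnAC; apply: leq_mul => //; rewrite -mulnA leq_mul2l pc orbT.
have := fact_broot c0; rewrite -/c => fb.
have E4 : (4 * N) ^ j = 2 ^ j * (2 * N) ^ j by rewrite -expnMn mulnA.
have E2 : (2 * c) ^ j = 2 ^ j * c ^ j by rewrite expnMn.
rewrite E2 in fb; rewrite E4 in Mc; rewrite (expnSr c j).
move: (c ^ j) (2 ^ j) ((2 * N) ^ j) (j`!) fb Mc => X Y Z f fb Mc.
apply: (@leq_ltn_trans (M * (Y * Z) * X)).
  have := leq_mul (leqnn (M * Z)) (ltnW fb); clear; lia.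
have X0 : 0 < X by case: X fb => //; rewrite muln0.
by rewrite mulnC ltn_pmul2l.
Qed.

Lemma achievable_asymp : exists D0, forall b a,
  achievable j b a -> j.+1 * a <= b * (broot i b + D0).
Proof.
(* [N] matches the bound of the unsplittable case after scaling by [j.+1], and [M] is what
   [split_gain_l] asks of the threshold. Below the cutoff [c0] the crude bound is charged entirely
   to [D0]. *)
pose N := j.+1 * j.+1; pose M := 4 * j * j.+1.
pose c0 := M * (4 * N) ^ j + 2 * N * j.+1 + M + 1.
have NE : N = j.+1 * j.+1 by []. have ME : M = 4 * j * j.+1 by [].
have N_gt0 : 0 < N by [].
have [cM cN c4] : [/\ M * (4 * N) ^ j < c0, 2 * N * j.+1 <= c0 & M <= c0].
  by rewrite /c0; set u := M * _; set v := 2 * N * _; clearbody u v M; split; lia.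
pose D0 := j.+1 * croot j 'C(c0, j); have D0E : D0 = j.+1 * croot j 'C(c0, j) by [].
clearbody c0 N M D0; exists D0 => b.
have [n] := ubnP b; elim: n b => // n IH b; rewrite ltnS => le_n a ach.
case: (leqP c0 (broot i b)) => [c0b|]; last first.
  move=> cc0; have := achievable_croot (ltn0Sn i) ach; rewrite mulnDr => H.
  apply: leq_trans (leq_addl _ _); rewrite D0E (mulnCA b) leq_mul2l /=.
  apply: leq_trans H _; rewrite mulnC leq_mul2l; apply/orP; right; apply: croot_mono => //.
  by apply: leq_trans (ltnW (broot_lt i b)) _; apply: leq_bin2l.
have {}cM := leq_trans cM c0b; have {}cN := leq_trans cN c0b; have {}c4 := leq_trans c4 c0b.
have {c0b D0E c0} c_gt0 : 0 < broot i b by apply: leq_ltn_trans cM.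
have [D HD DE] : exists2 D, N * D <= broot i b &
    forall p, p < (M * b %/ broot i b).+1 -> j`! * p < (D - j) ^ j.
  exists (croot j (M * b %/ broot i b)) => [|p]; first exact: croot_quot.
  by rewrite ltnS => ple; apply: leq_ltn_trans (croot_lt _ (ltn0Sn i));
    rewrite leq_mul2l ple orbT.
have cavg := kk_avg (ltnW (broot_lt i b)).
have half p := @broot_half b p.
have mono p := @broot_mono i p b.
move: (broot i b) cM cN c4 c_gt0 HD DE cavg half mono => c cM cN c4 c_gt0 HD DE cavg half mono.
have jc : 4 * j <= c by apply: leq_trans c4; rewrite ME leq_pmulr.
have [[s [t [a1 [a2 [[bE t0 th] [ach1 ach2 le_a]]]]]]|le_a|le_a] :=
  achievable_split (ltn0Sn i) ach DE.
- have s0 : 0 < s by apply: leq_trans th.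
  have H1 : j.+1 * a1 <= s * (broot i s + D0) by apply: IH ach1; lia.
  have H2 : j.+1 * a2 <= t * (broot i t + D0) by apply: IH ach2; lia.
  have rs : broot i s <= c by apply: mono; lia.
  have rt : broot i t <= c by apply: mono; lia.
  have Mle : M * b <= s * c by apply: leq_mul_ltn_divLR.
  suff K : s * broot i s + t * broot i t + j.+1 * t <= (s + t) * c.
    apply: (@leq_trans (j.+1 * (a1 + a2 + t))); first by rewrite leq_mul2l le_a.
    by rewrite bE !mulnDr; move: H1 H2; rewrite !mulnDr; lia.
  case: (leqP (2 * t) b) => tb; first by apply: (@split_gain_r j) => //;
    [exact: half | rewrite -ME].
  apply: (@split_gain_l j) => //; first by apply: half; lia.
  by rewrite -ME -bE.
- apply: (@leq_trans (b * c)); last by rewrite leq_mul2l leq_addr orbT.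
  apply: (@leq_trans (j.+1 * (j.+1 * D * b))); first by rewrite leq_mul2l le_a.
  by rewrite !mulnA -NE mulnC leq_mul2l HD orbT.
- apply: (@leq_trans (b * c)); last by rewrite leq_mul2l leq_addr orbT.
  apply: (@leq_trans (j.+1 * kk j b)); first by rewrite leq_mul2l le_a.
  apply: leq_trans cavg _; rewrite leq_mul2l; apply/orP; right.
  by rewrite subSS leq_subr.
Qed.

Lemma kk_lower b : 2 * j <= broot i b -> b * broot i b <= 4 * (j.+1 * kk j b).
Proof.
have := broot_lt i b; have : j.+1 * 'C(broot i b, j.+1) <= j.+1 * kk j b.
  by rewrite leq_mul2l leq_addr orbT.
rewrite mul_bin_left; move: (broot i b) (j.+1 * _) => c G le_G lt_b jc.
have le2 : 'C(c.+1, j) <= 2 * 'C(c, j) by apply: bin_succ_le2 => //; lia.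
apply: (@leq_trans (2 * 'C(c, j) * (2 * (c - j)))); first by apply: leq_mul; lia.
lia.
Qed.

(** This meets the bound of [achievable_asymp] up to O(b), so any gain of order [b * broot i b]
    decides the comparison. *)
Lemma kk_lower' b : 2 * j <= broot i b -> b * broot i b <= j.+1 * kk j b + 3 * j * b.
Proof.
have := broot_lt i b; have := broot_le i b; have : j.+1 * 'C(broot i b, j.+1) <= j.+1 * kk j b.
  by rewrite leq_mul2l leq_addr orbT.
rewrite mul_bin_left; move: (broot i b) (j.+1 * _) => c G le_G le_b lt_b jc.
have E := mul_bin_left c i; rewrite binS in lt_b.
move: ('C(c, j)) ('C(c, i)) le_G le_b lt_b E => u v le_G le_b lt_b E.
have vc : v * c <= 2 * j * b.
  apply: (@leq_trans (v * (2 * (c - i)))); first by rewrite leq_mul2l; lia.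
  by have := leq_mul (leqnn (2 * j)) le_b; lia.
have -> : c = (c - j) + j by lia.
have : (b - u) * (c - j) <= v * c by apply: leq_mul; lia.
have : b * (c - j) = u * (c - j) + (b - u) * (c - j) by rewrite -mulnDl subnKC.
rewrite mulnDr; lia.
Qed.

(** * The tight bound, given the slope of the cascade function *)

Variable N : nat.
Hypothesis N_gt0 : 0 < N.

(* [loss b p] bounds what a part of size [p] cut off from a family of size [b]
   contributes, cut members included. When [p] may be the size of the sets
   containing [x], up to [b] members are cut, whence the second summand. *)
Definition rate b p :=
  croot j p + 1 + (if 8 * N * b <= p * broot i b then broot i b %/ (4 * N) else 0).
Definition loss b p := p * rate b p.

Lemma rate_mono b : {homo rate b : p q / p <= q}.
Proof.
move=> p q pq; rewrite /rate !addn1 !addSn ltnS; apply: leq_add; first exact: croot_mono.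
case: ifP => // H; rewrite ifT //; apply: leq_trans H _; exact: leq_mul.
Qed.

Lemma loss_superadd b p q : loss b p + loss b q <= loss b (p + q).
Proof. by rewrite /loss mulnDl leq_add // leq_mul // rate_mono ?leq_addr ?leq_addl. Qed.

(** In 16, a factor 4 leaves room for the three summands of [rate], one factor 2 comes from
    [fact_broot] and one from [croot_bound]. *)
Lemma rate_top b e : 8 * N * j.+1 <= broot i b -> (16 * N) ^ j * e <= b ->
  N * rate b e <= broot i b.
Proof.
move=> Nc eb; have c_gt0 : 0 < broot i b by apply: leq_trans Nc; rewrite !muln_gt0 N_gt0.
have fb := fact_broot c_gt0.
have H : 4 * N * croot j e <= broot i b.
  apply: croot_bound; rewrite ?muln_gt0 //; first by lia.
  have := leq_mul (leqnn j`!) eb; move: fb.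
  have -> : 16 * N = 2 * (2 * (4 * N)) by lia.
  rewrite (expnMn 2 (2 * (4 * N))) (expnMn 2 (broot i b)).
  have Y0 : 0 < 2 ^ j by rewrite expn_gt0.
  move: ((2 * (4 * N)) ^ j) (2 ^ j) (broot i b ^ j) (j`!) Y0 => X Y C f Y0 H1 H2.
  rewrite -(ltn_pmul2l Y0); apply: leq_ltn_trans H1; move: H2; clear; lia.
have := leq_divM (broot i b) (4 * N); rewrite /rate.
move: (broot i b) (croot j e) H Nc => c r H Nc.
case: ifP => _; move: (_ %/ _) => d; nia.
Qed.

(** The j-th root of a number of order n^(j-1) is negligible against [n], and the bound on
    [p * broot i b] switches off the second summand of [rate]. *)
Lemma rate_low b p n : p <= 4 * n ^ i -> p * broot i b < 8 * N * b ->
  4 * N * j.+1 <= n -> 4 * j`! * (4 * N) ^ j < n -> N * rate b p <= n.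
Proof.
move=> pn pb Nn nbig; have n_gt0 : 0 < n by apply: leq_trans Nn; rewrite !muln_gt0 N_gt0.
have H : 2 * N * croot j p <= n.
  apply: croot_bound; rewrite ?muln_gt0 //; first by lia.
  have -> : 2 * (2 * N) = 4 * N by rewrite mulnA.
  have {}nbig : 4 * j`! * (4 * N) ^ j * n ^ i < n ^ j.
    by rewrite (expnS n) ltn_pmul2r // expn_gt0 n_gt0.
  apply: leq_ltn_trans nbig.
  by have := leq_mul (leqnn (j`! * (4 * N) ^ j)) pn; move: (j`!) (_ ^ j) (_ ^ i); clear; lia.
rewrite /rate ifN -?ltnNge // addn0 mulnDr muln1.
by move: (croot _ _) H => r H; nia.
Qed.

Lemma loss_half b e : 8 * N * j.+1 <= broot i b -> (16 * N) ^ j * e <= b -> 16 * j.+1 <= N ->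
  16 * (j.+1 * loss b e) <= e * broot i b.
Proof.
move=> Nc eb jN; have := rate_top Nc eb; rewrite /loss; move: (rate b e) (broot i b) => w c le.
apply: (@leq_trans (e * (N * w))); last by rewrite leq_mul2l le orbT.
by rewrite [j.+1 * _]mulnCA [16 * _]mulnCA leq_mul2l mulnA leq_mul2r jN !orbT.
Qed.

Lemma loss_absorbs b p a t : 0 < b -> 4 * N <= broot i b -> achievable j p a -> t <= b ->
  (t <= p) || (8 * N * b <= p * broot i b) -> a + t <= loss b p.
Proof.
move=> b0 Nc ach tb H; have := achievable_croot (ltn0Sn i) ach; rewrite /loss /rate.
move: (croot j p) => r le_a; apply: (@leq_trans (p * r + t)); first by rewrite leq_add2r mulnC.
rewrite -addnA mulnDr leq_add2l mulnDr muln1; case/orP: H => [tp|H].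
  exact: leq_trans tp (leq_addr _ _).
rewrite H; apply: leq_trans (leq_addl _ _); apply: leq_trans tb _.
have := divn_eq (broot i b) (4 * N); have := ltn_pmod (broot i b) (_ : 0 < 4 * N).
rewrite muln_gt0 N_gt0 /= => /(_ isT).
have : 1 <= broot i b %/ (4 * N) by rewrite leq_divRL ?muln_gt0 ?N_gt0 // mul1n.
move: (_ %/ _) (_ %% _) => d m; move: (broot i b) Nc H => c Nc H d1 m1 E.
(* Rounding costs at most a factor 2: hence [8 * N] in the test of [rate] against [4 * N] in its
   quotient. *)
have : c <= 8 * N * d by rewrite E; have := leq_mul (leqnn (4 * N)) d1; lia.
move/(leq_mul (leqnn p)) => H2; have {H2} := leq_trans H H2.
by rewrite [p * _]mulnCA leq_pmul2l ?muln_gt0 ?N_gt0.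
Qed.

(** The parts set aside now exceed a fixed fraction of [b]. After scaling by [j.+1], the asymptotic
    bounds for [q] and [p] gain [p * d + e * c], where [d] is at least c/(4j) because [p] is at most
    half of [b]. This gain has order [b * c] and beats the O(b) errors together with the loss of
    [e]. *)
Lemma tight_far D0 b q p e a' a t :
  (forall b a, achievable j b a -> j.+1 * a <= b * (broot i b + D0)) ->
  8 * N * j.+1 <= broot i b -> 16 * j.+1 <= N ->
  4 * j * (16 * N) ^ j * (D0 + 4 * j + 1) <= broot i b ->
  achievable j q a' -> achievable j p a -> q + p + e = b -> 2 * p <= b -> t <= b ->
  (16 * N) ^ j * e <= b -> b < (16 * N) ^ j * (p + e) ->
  a' + a + t + loss b e <= kk j b.
Proof.
move=> HD0 Nc jN cbig ach' ach E pb tb eb peb.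
have He := loss_half Nc eb jN.
have jc : 4 * j <= broot i b by apply: leq_trans Nc; apply: leq_mul; lia.
have Hlow := @kk_lower' b; have := broot_half pb jc.
have H1 := HD0 _ _ ach'; have H2 := HD0 _ _ ach.
have rq : broot i q <= broot i b by apply: broot_mono; lia.
have rp : broot i p <= broot i b by apply: broot_mono; lia.
move: (broot i b) (broot i q) (broot i p) (kk j b) (loss b e) (_ ^ j) Nc He jc Hlow H1 H2 rq rp cbig eb peb
  => c cq cp G w Delta Nc He jc Hlow H1 H2 rq rp cbig eb peb gap.
have {}Hlow : b * c <= j.+1 * G + 3 * j * b by apply: Hlow; lia.
pose d := c - cp; have cE : c = cp + d by rewrite /d subnKC.
rewrite -/d in gap.
have key : (D0 + 4 * j + 1) * b + j.+1 * w <= p * d + e * c.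
  rewrite -(@leq_pmul2l (4 * j)) //.
  have g1 : 4 * j * (D0 + 4 * j + 1) * b <= c * (p + e).
    apply: (@leq_trans (4 * j * Delta * (D0 + 4 * j + 1) * (p + e)));
      last by rewrite leq_mul2r cbig orbT.
    by have := leq_mul (leqnn (4 * j * (D0 + 4 * j + 1))) (ltnW peb); lia.
  have g2 := leq_mul (leqnn p) gap.
  have g3 := leq_mul (leqnn j) He.
  have g4 : e * c <= j * (e * c) by rewrite leq_pmull.
  move: g1 g2 g3 g4; clear; lia.
rewrite -(@leq_pmul2l j.+1) //.
have k1 : q * (cq + D0) <= q * (c + D0) by rewrite leq_mul2l leq_add2r rq orbT.
have k2 : p * c = p * cp + p * d by rewrite -mulnDr -cE.
have k3 := leq_mul (leqnn j.+1) tb.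
move: H1 H2 k1 k2 k3 key Hlow; rewrite -E; clear; lia.
Qed.

Lemma achievable_tight : 16 * j.+1 <= N -> exists c1, forall b, c1 <= broot i b ->
  (forall p, p <= b -> (16 * N) ^ j * p <= b -> kk j (b - p) + loss b p <= kk j b) ->
  forall a, achievable j b a -> a <= kk j b.
Proof.
move=> jN; have [D0 HD0] := achievable_asymp.
(* The factor 8 lets the unsplittable bound and [loss b e] fit together under the estimate of
   [kk_lower]. *)
pose N2 := 8 * (j.+1 * j.+1); have N2E : N2 = 8 * (j.+1 * j.+1) by [].
have N2_gt0 : 0 < N2 by [].
clearbody N2.
exists (8 * N * j.+1 + 2 * N2 * j.+1 + 8 * N * (4 * N2) ^ j + 1 +
  4 * j * (16 * N) ^ j * (D0 + 4 * j + 1)) => b.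
set x1 := 8 * N * _; set x2 := 2 * N2 * _; set x3 := 8 * N * _;
  set x4 := _ * (D0 + _ + _) => c1.
have [Nc cN2 cM cbig] : [/\ x1 <= broot i b, x2 <= broot i b, x3 < broot i b & x4 <= broot i b].
  by move: (broot i b) c1; clearbody x1 x2 x3 x4; clear; move=> c ?; split; lia.
move: Nc cN2 cM cbig => {c1}; rewrite /x1 /x2 /x3 /x4 {x1 x2 x3 x4} => Nc cN2 cM cbig slope.
have N4 : 4 * N <= broot i b.
  by apply: leq_trans Nc; rewrite -[4 * N]muln1; apply: leq_mul => //; rewrite leq_mul2r orbT.
have jc : 2 * j <= broot i b.
  by apply: leq_trans Nc; apply: leq_mul => //; rewrite -[2]muln1; apply: leq_mul.
have c_gt0 : 0 < broot i b by apply: leq_ltn_trans cM.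
have b_gt0 : 0 < b.
  by apply: leq_trans (broot_le i b); rewrite bin_gt0; apply: leq_trans jc; rewrite leq_pmull.
have [D HD DE] : exists2 D, N2 * D <= broot i b &
    forall p, p < (8 * N * b %/ broot i b).+1 -> j`! * p < (D - j) ^ j.
  exists (croot j (8 * N * b %/ broot i b)) => [|p]; first exact: croot_quot.
  by rewrite ltnS => ple; apply: leq_ltn_trans (croot_lt _ (ltn0Sn i));
    rewrite leq_mul2l ple orbT.
(* Here [q] is the size of the part still followed, and [e] the total size of the parts cut off so
   far. *)
suff H q e a : q + e = b -> (16 * N) ^ j * e <= b -> achievable j q a ->
  a + loss b e <= kk j b.
  by move=> a ach; rewrite -[a]addn0; apply: leq_trans (H b 0 a _ _ ach);
    rewrite ?addn0 ?muln0 // leq_addr.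
have [n] := ubnP q; elim: n q e a => // n IH q e a lt_n qe eb ach.
have step q' p a1 a2 t : achievable j q' a1 -> achievable j p a2 -> q' + p = q -> 0 < p ->
    2 * p <= b -> t <= b -> (t <= p) || (8 * N * b <= p * broot i b) ->
      a1 + a2 + t + loss b e <= kk j b.
  move=> ach1 ach2 E p0 pb tb tp.
  have Eb : q' + p + e = b by rewrite E.
  case: (leqP ((16 * N) ^ j * (p + e)) b) => far;
    last exact: tight_far HD0 Nc jN cbig ach1 ach2 Eb pb tb eb far.
  have := IH q' (p + e) a1 _ _ far ach1; rewrite addnA => /(_ _ Eb) H.
  apply: leq_trans (H _); last by lia.
  rewrite -!addnA leq_add2l addnA; apply: leq_trans (loss_superadd b p e).
  by rewrite leq_add2r; apply: loss_absorbs.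
have [[s [t [a1 [a2 [[qE t0 th] [ach1 ach2 le_a]]]]]]|le_a|le_a] :=
  achievable_split (ltn0Sn i) ach DE.
- apply: (@leq_trans (a1 + a2 + t + loss b e)); first by rewrite leq_add2r.
  have s0 : 0 < s by apply: leq_trans th.
  have big : 8 * N * b <= s * broot i b by apply: leq_mul_ltn_divLR.
  case: (leqP s t) => st; last by apply: (step s t); rewrite ?leqnn //; lia.
  by rewrite [a1 + a2]addnC; apply: (step t s); rewrite ?big ?orbT //; lia.
- rewrite -(@leq_pmul2l (8 * j.+1)) //.
  have Hl := loss_half Nc eb jN; have Hk := kk_lower jc.
  have Ha : 8 * (j.+1 * a) <= b * broot i b.
    apply: (@leq_trans (N2 * D * q)); last by rewrite mulnC; apply: leq_mul => //; lia.
    apply: (@leq_trans (8 * (j.+1 * (j.+1 * D * q)))); first by rewrite !leq_mul2l le_a !orbT.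
    by rewrite N2E !mulnA.
  have He : e * broot i b <= b * broot i b by rewrite leq_mul2r; apply/orP; right; lia.
  by move: Hl Hk Ha He; clear; lia.
apply: leq_trans (slope e _ eb); last by lia.
by rewrite leq_add2r; apply: leq_trans le_a _; apply: kk_mono; lia.
Qed.
End Bounds.

(** * Slope of the cascade function *)

(** The offset [d = 0] gives the prescribed size of B, and [d = 1] the claimed maximum. *)
Definition csum (c : nat -> nat) d l := \sum_(1 <= m < l.+1) 'C(c m, m + d).

Lemma csumS c d l : csum c d l.+1 = 'C(c l.+1, l.+1 + d) + csum c d l.
Proof. by rewrite /csum big_nat_recr //= addnC. Qed.

Lemma csum_mono c d l l' : l <= l' -> csum c d l <= csum c d l'.
Proof.
by move/subnKC <-; elim: (l' - l) => [|n IH];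
  rewrite ?addn0 // addnS csumS (leq_trans IH) ?leq_addl.
Qed.

Lemma csum0 c d : csum c d 0 = 0.
Proof. by rewrite /csum big_geq. Qed.

Section Cascade.
Variables (c : nat -> nat) (j : nat).
Hypothesis c_incr : forall m, 0 < m -> m < j -> c m < c m.+1.

Lemma csum_lt l : l <= j -> csum c 0 l < 'C((c l).+1, l).
Proof.
elim: l => [|l IH] lj; first by rewrite csum0 bin0.
rewrite csumS binS addn0 ltn_add2l.
case: l IH lj => [|l] IH lj; first by rewrite csum0 bin0.
by apply: leq_trans (IH (ltnW lj)) _; apply: leq_bin2l; apply: c_incr.
Qed.

Lemma csum_lt_next l : l < j -> csum c 0 l < 'C(c l.+1, l).
Proof.
case: l => [|l] lj; first by rewrite csum0 bin0.
by apply: leq_trans (csum_lt (ltnW lj)) _; apply: leq_bin2l; apply: c_incr.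
Qed.

Lemma broot_csum l : l < j -> broot l (csum c 0 l.+1) = c l.+1.
Proof.
move=> lj; apply: broot_uniq; last exact: csum_lt.
by rewrite csumS addn0 leq_addr.
Qed.

Lemma kk_csum l : l <= j -> kk l (csum c 0 l) = csum c 1 l.
Proof.
elim: l => [|l IH] lj; first by rewrite !csum0.
by rewrite !csumS addn0 addn1 kk_cascade ?csum_lt_next // IH // ltnW.
Qed.
End Cascade.

Section Slope.
Variables (c : nat -> nat) (i N mu : nat).
Local Notation j := i.+1.
Hypothesis c_incr : forall m, 0 < m -> m < j -> c m < c m.+1.
Hypothesis c_large : forall m, 0 < m -> m <= j -> mu < c m.
Hypothesis N_large : 16 * j.+1 <= N.
Hypothesis mu_large : 8 * N * j.+1 <= mu.
Hypothesis mu_large' : 4 * j`! * (4 * N) ^ j <= mu.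
Local Notation S := (csum c 0).
Local Notation b := (S j).

Lemma N_pos : 0 < N. Proof. by apply: leq_trans N_large. Qed.

(** Below the top digit, [p] has order at most c_m^i, as [rate_low] requires. The bound by [2 * S i]
    keeps [p * c j] under [8 * N * b], since [S i < 'C(c j, i)], which has order b / c_j. *)
Lemma slope_low m p : 0 < m -> m < j -> p <= 4 * 'C(c m, m) -> p <= 2 * S i ->
  N * rate i N b p <= c m.
Proof.
move=> m0 mj pC pS; have cm := c_large m0 (ltnW mj).
apply: rate_low; first exact: N_pos.
- apply: leq_trans pC _; rewrite leq_mul2l /=.
  apply: leq_trans (_ : c m ^ m <= _); last by rewrite leq_pexp2l //; lia.
  by apply: leq_trans (fact_bin_le _ _); rewrite leq_pmull // fact_gt0.
- rewrite (broot_csum c_incr) //; have v_gt := csum_lt_next c_incr (ltnSn i).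
  have E := mul_bin_left (c j) i; have cj := c_large (ltn0Sn i) (leqnn j).
  have le_b : 'C(c j, j) <= b by rewrite csumS addn0 leq_addr.
  have jn : 2 * j <= c j.
    apply: leq_trans (ltnW cj); apply: leq_trans mu_large; apply: leq_mul => //.
    by rewrite -[2]muln1; apply: leq_mul => //; apply: N_pos.
  have u_gt0 : 0 < 'C(c j, j) by rewrite bin_gt0; lia.
  have jN : 16 * j <= N by lia.
  move: ('C(c j, j)) ('C(c j, i)) E le_b u_gt0 v_gt => u v E le_b u_gt0 v_gt.
  move: (S i) (csum c 0 j) (c j) pS v_gt E le_b jn {cj pC} => s B n pS v_gt E le_b jn.
  have h1 : p * n <= (2 * v) * (2 * (n - i)) by apply: leq_mul; lia.
  have h2 := leq_mul (leqnn (4 * j)) le_b.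
  have h3 : (16 * j) * B <= N * B by rewrite leq_mul2r jN orbT.
  have h4 : 0 < j * B by rewrite muln_gt0 /=; lia.
  by move: h1 h2 h3 h4 E; clear; lia.
- by apply: leq_trans (ltnW cm); apply: leq_trans mu_large; rewrite !leq_mul2r; lia.
by apply: leq_ltn_trans mu_large' cm.
Qed.

Lemma csum_le2 m : 0 < m -> m <= j -> S m <= 2 * 'C(c m, m).
Proof.
case: m => // m _ mj; rewrite csumS addn0 mul2n -addnn leq_add2l.
apply: leq_trans (ltnW (csum_lt_next c_incr mj)) _.
have cm := c_large (ltn0Sn m) mj.
have mc : 2 * m.+1 <= c m.+1.
  apply: leq_trans (ltnW cm); apply: leq_trans mu_large; apply: leq_mul; last by lia.
  by rewrite -[2]muln1; apply: leq_mul => //; apply: N_pos.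
by rewrite -(@leq_pmul2l m.+1) // mul_bin_left leq_mul2r; lia.
Qed.

Lemma loss_bound t x w n m d : t <= 4 * x -> N * w <= n -> m <= j -> 2 * m <= n -> d = n - m ->
  m.+1 * (t * w) <= x * d.
Proof.
move=> tx wn mj mn dE; rewrite -(@leq_pmul2l N) ?N_pos //.
apply: (@leq_trans (m.+1 * (4 * x * n))).
  by rewrite mulnCA leq_mul2l mulnCA leq_mul //= orbT.
have h1 : n <= 2 * d by lia.
have h2 : 8 * m.+1 <= N by lia.
have := leq_mul (leqnn (m.+1 * 4 * x)) h1; have := leq_mul h2 (leqnn (x * d)); clear; lia.
Qed.

(** If [t] reaches only into the lower terms, the top digit is untouched and induction applies.
    Otherwise [t'] comes out of the top binomial, where by [kk_avg] the average slope is at least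
    (c_{m+1} - (m+1)) / (m+2), while [rate] is at most a fraction 1/N of a digit. *)
Lemma cascade_slope_aux m t : 0 < m -> m <= j -> t <= S m -> (m = j ->
  (16 * N) ^ j * t <= b) ->
  kk m (S m - t) + loss i N b t <= kk m (S m).
Proof.
elim: m t => // m IH t _ mj tS tj.
have two_le m' : 0 < m' -> m' <= j -> 2 * j <= c m'.
  move=> m'0 m'j; apply: leq_trans (ltnW (c_large m'0 m'j)); apply: leq_trans mu_large.
  by apply: leq_mul => //; rewrite -[2]muln1; apply: leq_mul => //; apply: N_pos.
case: (leqP t (S m)) => tm.
  case: m IH mj tS tj tm => [|m] IH mj tS tj tm.
    by move: tm; rewrite csum0 leqn0 => /eqP ->; rewrite subn0 /loss mul0n addn0.
  have mj' : m.+1 < j by [].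
  have H := IH t isT (ltnW mj') tm; rewrite [S m.+2]csumS addn0 -addnBA //.
  have lt := csum_lt_next c_incr mj'.
  rewrite !kk_cascade //; last by apply: leq_ltn_trans (leq_subr _ _) lt.
  by rewrite -addnA leq_add2l; apply: H => mE; rewrite mE ltnn in mj'.
pose t' := t - S m; have tE : t = S m + t' by rewrite /t' subnKC // ltnW.
have t'C : t' <= 'C(c m.+1, m.+1) by move: tS; rewrite tE csumS addn0 addnC leq_add2r.
have avg : m.+2 * kk m.+1 (S m.+1 - t) + t' * (c m.+1 - m.+1) <= m.+2 * 'C(c m.+1, m.+2).
  have -> : S m.+1 - t = 'C(c m.+1, m.+1) - t' by rewrite tE csumS addn0; lia.
  apply: leq_trans (_ : ('C(c m.+1, m.+1) - t') * (c m.+1 - m.+1) + t' * (c m.+1 - m.+1) <= _).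
    by rewrite leq_add2r kk_avg // leq_subr.
  by rewrite -mulnDl subnK // mul_bin_left mulnC.
have kkE : kk m.+1 (S m.+1) = 'C(c m.+1, m.+2) + kk m (S m).
  by rewrite csumS addn0 kk_cascade ?(csum_lt_next c_incr).
suff main : m.+2 * loss i N b t <= t' * (c m.+1 - m.+1) + m.+2 * kk m (S m).
  by rewrite kkE -(@leq_pmul2l m.+2) // (mulnDr _ (kk _ _)) (mulnDr _ 'C(_, _));
  move: avg main; move: (kk m.+1 _) (loss _ _ _ _) => u v; lia.
(* If [t'] is at least half of [t], the top binomial pays for the whole loss. *)
case: (leqP (S m) t') => tt'.
  apply: leq_trans (leq_addr _ _); apply: (@loss_bound t t' _ (c m.+1)) => //.
  - by rewrite tE; lia.
  - have [mE|mN] := eqVneq m.+1 j.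
      have := @rate_top i N N_pos b t; rewrite (broot_csum c_incr) // mE; apply;
        last exact: tj.
      by apply: leq_trans mu_large (ltnW (c_large _ _)).
    have mj' : m.+1 < j by rewrite ltn_neqAle mN.
    apply: slope_low => //.
      by rewrite tE; move: t'C tt'; clear; lia.
    have mi : m.+1 <= i by [].
    by apply: leq_trans tS (leq_trans (csum_mono c 0 mi) _); rewrite leq_pmull.
  - by apply: leq_trans (two_le _ _ mj) => //; rewrite leq_mul2l.
(* Now [t < 2 * S m], and the lower terms, which vanish entirely, pay alone with [kk m (S m)]. *)
have m0 : 0 < m by case: (m) tt' => //; rewrite csum0.
case: m IH {tS} m0 mj tj tm @t' tE t'C avg kkE tt' => // m IH _ mj tj tm t' tE t'C avg kkE tt'.
have mj' : m.+1 < j by [].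
have S2 := csum_le2 (ltn0Sn m) (ltnW mj').
apply: leq_trans (leq_addl _ _).
apply: leq_trans (_ : m.+3 * 'C(c m.+1, m.+2) <= _); last first.
  by rewrite leq_mul2l (kk_csum c_incr (ltnW mj')) csumS addn1 leq_addr.
rewrite leq_mul2l -(@leq_pmul2l m.+2) // mul_bin_left [X in _ <= X]mulnC.
have t2 : t <= 2 * S m.+1 by rewrite tE; lia.
have t4 : t <= 4 * 'C(c m.+1, m.+1) by move: t2 S2; clear; lia.
apply: (@loss_bound t 'C(c m.+1, m.+1) _ (c m.+1)) => //; last 1 first.
- by apply: leq_trans (two_le _ _ (ltnW mj')) => //; rewrite leq_mul2l ltnW.
- apply: slope_low => //; apply: leq_trans t2 _.
  by rewrite leq_mul2l (csum_mono _ _ (_ : m.+1 <= i)).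
- exact: ltnW.
Qed.

End Slope.

(** * Extremal families and the theorem *)

Definition in_clique n l (K B : {fset nat}) :=
  [/\ K `<=` B, #|` B `\` K| = l & forall x, x \in B -> x \notin K -> x < n].

Lemma in_cliqueU1 n l K B : n \notin K -> n \in B ->
  in_clique n.+1 l.+1 K B <-> in_clique n l (n |` K) B.
Proof.
move=> nK nB; have E : #|` B `\` K| = #|` B `\` (n |` K)|.+1.
  rewrite (cardfsD1 n (B `\` K)) !inE nK nB /=; congr _.+1; congr (size (enum_fset _)).
  by apply/fsetP => z; rewrite !inE negb_or andbA.
split=> [[KB c H]|[KB c H]]; split; rewrite ?fsubUset ?fsub1set ?nB ?KB //.
- by apply: succn_inj; rewrite -E.
- by move=> x xB; rewrite !inE negb_or => /andP[xn xK]; have := H x xB xK;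
  rewrite ltnS leq_eqVlt (negbTE xn).
- by move: KB; rewrite fsubUset => /andP[].
- by rewrite E c.
move=> x xB xK; have [->//|xn] := eqVneq x n.
by apply/ltnW; rewrite ltnS; apply: H; rewrite // !inE negb_or xn.
Qed.

Lemma in_clique0 n K B : in_clique n 0 K B <-> B = K.
Proof.
split=> [[KB /cardfs0_eq/eqP c _]|->]; first by rewrite fsetD_eq0 in c; apply/eqP;
  rewrite eqEfsubset c.
by split; rewrite ?fsetDv ?cardfs0 // => x ->.
Qed.

Lemma cliqueP n l (K : {fset nat}) : (forall x, x \in K -> n <= x) ->
  exists2 Q : setfam, forall B, B \in Q <-> in_clique n l K B & #|` Q| = 'C(n, l).
Proof.
elim: n l K => [|n IH] [|l] K HK.
1,3: by exists [fset K]; [move=> B; rewrite inE in_clique0;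
  split => [/eqP|->] | rewrite cardfs1 bin0].
  exists fset0; last by rewrite cardfs0.
  move=> B; rewrite inE; split => // -[KB c H].
  have /fset_neq0P[x] : 0 < #|` B `\` K| by rewrite c.
  by rewrite inE => /andP[xK xB]; have := H x xB xK.
have nK : n \notin K by apply/negP => /HK; rewrite ltnn.
have [|Q1 H1 c1] := IH l.+1 K; first by move=> x /HK/ltnW.
have [|Q2 H2 c2] := IH l (n |` K); first by move=> x; rewrite !inE => /orP[/eqP->//|/HK/ltnW].
have Q1n B : B \in Q1 -> n \notin B.
  by move=> /H1[_ _ H]; apply/negP => /H/(_ nK); rewrite ltnn.
exists (Q1 `|` Q2).
  move=> B; have [nB|nB] := boolP (n \in B).
    rewrite in_cliqueU1 // -H2 inE; split => [/orP[/Q1n|//]|->]; last by rewrite orbT.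
    by rewrite nB.
  rewrite inE; split=> [/orP[/H1[KB c H]|/H2[KB _ _]]|[KB c H]].
  - by split=> // x xB xK; apply/ltnW/H.
  - by move: KB nB; rewrite fsubUset fsub1set => /andP[->].
  apply/orP; left; apply/H1; split=> // x xB xK; have := H x xB xK.
  by rewrite ltnS leq_eqVlt => /orP[/eqP E|//]; rewrite -E xB in nB.
have -> : #|` Q1 `|` Q2| = #|` Q1| + #|` Q2|.
  rewrite cardfsU (_ : Q1 `&` Q2 = fset0) ?cardfs0 ?subn0 //.
  apply/fsetP => B; rewrite !inE; apply/negP => /andP[/Q1n nB /H2[KB _ _]].
  by move: KB nB; rewrite fsubUset fsub1set => /andP[->].
by rewrite c1 c2 binS.
Qed.

(** Outside [K] these are initial segments of the colexicographic order. The leading terms are the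
    cliques below [n = c l.+1]; the rest comes from the core enlarged by [n], and removing [n] from
    one of those sets lands in the clique [G1]. *)
Lemma cascade_families c l (K : {fset nat}) :
  (forall m, 0 < m -> m < l -> c m < c m.+1) -> (0 < l -> forall x, x \in K -> c l < x) ->
  exists F G, [/\ full_over K l.+1 F G,
    forall C, C \in F -> forall x, x \in C -> x \notin K -> x <= c l,
    forall B, B \in G -> K `<=` B /\ #|` B `\` K| = l &
    #|` F| = csum c 1 l /\ #|` G| = csum c 0 l].
Proof.
elim: l K => [|l IH] K c_incr HK.
  by exists fset0, fset0; split=> //; rewrite ?csum0 ?cardfs0.
set n := c l.+1; have {}HK x : x \in K -> n < x by apply: HK.
have [G1 HG1 cG1] := @cliqueP n l.+1 K (fun x xK => ltnW (HK x xK)).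
have [F1 HF1 cF1] := @cliqueP n l.+2 K (fun x xK => ltnW (HK x xK)).
have nK : n \notin K by apply/negP => /HK; rewrite ltnn.
have lt_n : 0 < l -> c l < n by move=> l0; apply: c_incr.
have [||F2 [G2 [H2 ltF2 HG2 [cF2 cG2]]]] := IH (n |` K).
- by move=> m m0 ml; apply: c_incr => //; apply: ltnW.
- move=> l0 x; rewrite !inE => /orP[/eqP->|/HK]; first exact: lt_n.
  exact/ltn_trans/lt_n.
have nF1 C : C \in F1 -> n \notin C.
  by move=> /HF1[_ _ H]; apply/negP => /H/(_ nK); rewrite ltnn.
have nG1 C : C \in G1 -> n \notin C.
  by move=> /HG1[_ _ H]; apply/negP => /H/(_ nK); rewrite ltnn.
have F2P C : C \in F2 -> in_clique n.+1 l.+2 K C.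
  move=> CF; have [nKC cC _] := H2 _ CF; rewrite in_cliqueU1 //; last first.
    by move: nKC; rewrite fsubUset fsub1set => /andP[].
  split=> // x xC xK; apply: leq_ltn_trans (ltF2 _ CF x xC xK) (lt_n _).
  (* Nothing is known of [c 0], but for [l = 0] the family [F2] is empty. *)
  by case: (l) cF2 => // /eqP; rewrite csum0 cardfs_eq0 => /eqP F20; rewrite F20 in CF.
have G2P B : B \in G2 -> [/\ n \in B, K `<=` B & #|` B `\` K| = l.+1].
  move=> BG; have [nKB cB] := HG2 _ BG; move: nKB; rewrite fsubUset fsub1set => /andP[nB KB].
  split=> //; rewrite (cardfsD1 n) !inE nK nB -cB; congr _.+1; congr (size (enum_fset _)).
  by apply/fsetP => z; rewrite !inE negb_or andbA.
have disj (Q1 Q2 : setfam) : (forall C, C \in Q1 -> n \notin C) -> (forall C, C \in Q2 ->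
  n \in C) ->
    #|` Q1 `|` Q2| = #|` Q1| + #|` Q2|.
  move=> h1 h2; rewrite cardfsU (_ : Q1 `&` Q2 = fset0) ?cardfs0 ?subn0 //.
  by apply/fsetP => B; rewrite !inE; apply/negP => /andP[/h1 nB /h2]; apply/negP.
exists (F1 `|` F2), (G1 `|` G2); split.
- move=> C; rewrite inE => /orP[CF|CF].
    have [KC cC H] := (HF1 _).1 CF; split=> // y yC yK; rewrite inE; apply/orP; left;
      apply/HG1; split.
    + by rewrite fsubsetD1 KC.
    + apply: succn_inj; rewrite -cC (cardfsD1 y (C `\` K)) !inE yC yK; congr _.+1;
      congr (size (enum_fset _)).
      by apply/fsetP => z; rewrite !inE; case: (z \in K); rewrite ?andbF.
    by move=> x; rewrite inE => /andP[_]; apply: H.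
  have [nKC _ CG] := H2 _ CF; have [KC cC H] := F2P _ CF; split=> // y yC yK; rewrite inE.
  have [yn|yn] := eqVneq y n; last first.
    by apply/orP; right; apply: CG; rewrite // !inE negb_or yn.
  apply/orP; left; apply/HG1; split.
  + by rewrite fsubsetD1 KC.
  + apply: succn_inj; rewrite -cC (cardfsD1 y (C `\` K)) !inE yC yK; congr _.+1;
    congr (size (enum_fset _)).
    by apply/fsetP => z; rewrite !inE; case: (z \in K); rewrite ?andbF.
  by move=> x; rewrite !inE yn => /andP[xn xC xK]; have := H x xC xK;
    rewrite ltnS leq_eqVlt (negbTE xn).
- by move=> C; rewrite inE => /orP[/HF1|/F2P] [_ _ H] x xC xK;
  [apply/ltnW/H | rewrite -ltnS; apply: H].
- by move=> B; rewrite inE => /orP[/HG1[]|/G2P[]].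
rewrite !csumS addn0 addn1 -cF1 -cG1 -cF2 -cG2; split; apply: disj => //.
- by move=> C /H2[+ _ _]; rewrite fsubUset fsub1set => /andP[].
- by move=> B /G2P[].
Qed.

(** * The upper bound for cascades and the theorem *)

Lemma achievable_admissible k r A0 B0 : admissible r.+1 k.+1 A0 B0 ->
  achievable k #|` B0| #|` A0|.
Proof.
move=> [HA [HB HAB]]; exists r, A0, B0; split=> // C CA; apply: leq_trans (HAB _ CA) _.
apply: leq_trans (_ : #|` [fset C `\ y | y in removable B0 C]| <= _);
  last by apply: leq_imfset_card.
apply: fsubset_leq_card; apply/fsubsetP => Y; rewrite !inE => /andP[YB YC].
have E : #|` C| = #|` Y|.+1 by rewrite HA // HB.
have /fset_neq0P[y] : 0 < #|` C `\` Y| by rewrite cardfsDS // E; lia.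
move=> yCY; have CE := cover_eq YC E yCY; move: yCY; rewrite inE => /andP[yY yC].
have YE : C `\ y = Y by rewrite CE fsetU1K.
by apply/imfsetP; exists y => //=; rewrite !inE yC YE.
Qed.

Lemma admissible_full K k r F G : full_over K k F G -> (forall C, C \in F -> #|` C| = r) ->
  (forall B, B \in G -> #|` B| = r.-1) -> admissible r k F G.
Proof.
move=> HF HC HB; split=> //; split=> // C CF; have [KC cC CG] := HF _ CF.
have <- : #|` [fset C `\ y | y in C `\` K]| = k.
  rewrite -cC; apply: card_in_imfset => y z; rewrite !inE => /andP[_ yC] /andP[_ zC] E.
  apply/eqP; have : y \notin C `\ z by rewrite -E !inE eqxx.
  by rewrite !inE yC andbT negbK.
apply: fsubset_leq_card; apply/fsubsetP => _ /imfsetP[y /= + ->].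
by rewrite !inE => /andP[yK yC]; rewrite CG ?fsubsetDl.
Qed.

Lemma achievable_cascade i : exists mu, forall c,
  (forall m, 0 < m -> m < i.+1 -> c m < c m.+1) -> (forall m, 0 < m -> m <= i.+1 ->
    mu < c m) ->
  forall a, achievable i.+1 (csum c 0 i.+1) a -> a <= csum c 1 i.+1.
Proof.
pose N := 16 * i.+2; have N_gt0 : 0 < N by [].
have [c1 H] := @achievable_tight i N N_gt0 (leqnn _).
exists (8 * N * i.+2 + 4 * (i.+1)`! * (4 * N) ^ i.+1 + c1) => c c_incr c_large a.
set x1 := 8 * N * _ in c_large; set x2 := 4 * _ * _ in c_large.
have big x m : x <= x1 + x2 + c1 -> 0 < m -> m <= i.+1 -> x < c m.
  by move=> le m0 mi; apply: leq_ltn_trans le (c_large _ m0 mi).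
rewrite -(kk_csum c_incr (leqnn _)); apply: H.
  by rewrite (broot_csum c_incr) //; apply/ltnW/big; rewrite ?leq_addl.
move=> p pb Db; apply: (@cascade_slope_aux c i N (x1 + x2)) => //.
- by move=> m; apply: big; rewrite leq_addr.
- exact: leq_addr.
- exact: leq_addl.
Qed.

Theorem theorem2 :
  forall k : nat, 1 <= k ->
  exists mu : nat,
    forall (r : nat) (c : nat -> nat),
      k <= r ->
      (forall i, 1 <= i < k -> mu < c i) ->
      (forall i, 1 <= i -> i.+1 < k -> c i < c i.+1) ->
      f_is r k (\sum_(1 <= i < k) 'C(c i, i)) (\sum_(1 <= i < k) 'C(c i, i.+1)).
Proof.
case=> // j _.
have [mu Hmu] : exists mu, forall c, (forall m, 0 < m -> m < j -> c m < c m.+1) ->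
    (forall m, 0 < m -> m <= j -> mu < c m) ->
    forall a, achievable j (csum c 0 j) a -> a <= csum c 1 j.
  (* For [j = 0] both sums are empty, and an empty B forces an empty A. *)
  case: j => [|i]; last exact: achievable_cascade.
  exists 0 => c _ _ a; rewrite !csum0 => -[r [F [G [_ HA /cardfs0_eq G0 <-]]]].
  by rewrite G0 in HA; rewrite (adm0 HA) cardfs0.
exists mu => -[//|r] c jr c_large c_incr.
have {}c_incr m : 0 < m -> m < j -> c m < c m.+1 by move=> m0 mj; apply: c_incr.
have {}c_large m : 0 < m -> m <= j -> mu < c m by move=> m0 mj; apply: c_large; rewrite m0.
have -> : \sum_(1 <= i < j.+1) 'C(c i, i) = csum c 0 j by apply: eq_bigr => m _; rewrite addn0.
have -> : \sum_(1 <= i < j.+1) 'C(c i, i.+1) = csum c 1 j by apply: eq_bigr => m _;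
  rewrite addn1.
split; last by move=> A0 B0 /achievable_admissible ach cB; rewrite cB in ach; apply: Hmu ach.
(* A core of [r - j] elements pads the sets to size [r.+1]; its elements lie above [c j], clear of
   the cliques. *)
pose K := [fset (c j + x).+1 | x in iota 0 (r - j)].
have cK : #|` K| = r - j.
  rewrite card_imfset /=; last by move=> x y [/addnI].
  by rewrite undup_id ?iota_uniq // size_iota.
have [|F [G [HF _ HG [cF cG]]]] := @cascade_families c j K c_incr.
  by move=> _ x /imfsetP[y _ ->]; rewrite ltnS leq_addr.
exists F, G; split=> //; apply: (@admissible_full K) => // C CF.
  have [KC cC _] := HF _ CF; have := cardfsDS KC; have := fsubset_leq_card KC.
  by rewrite cC cK; lia.
have [KC cC] := HG _ CF; have := cardfsDS KC; have := fsubset_leq_card KC.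
by rewrite cC cK /=; lia.
Qed.
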